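(* Let $n\geqslant 9$, $\alpha\in[0,1)$, and let $G$ be a graph having the minimum $A_\alpha$-index among all connected graphs of order $n$ with independence number $n-3$. Then $G\cong H_3(s,t,k)$ for some nonnegative integers $s,t,k$ with $|s-k|\leqslant 1$ and $s+t+k=n-5$. Furthermore: (i) if $\alpha\in[\frac12,1)$ and $n=3m$, then $G\cong H_3(m-1,m-3,m-1)$; (ii) if $\alpha\in[\frac12,1)$ and $n=3m+1$, then $G\cong H_3(m-1,m-2,m-1)$; (iii) if $\alpha\in[\frac{11}{20},1)$ and $n=3m+2$, then $G\cong H_3(m,m-3,m)$.
   Context: All graphs are finite, simple and connected. For a graph $G$ with adjacency matrix $A(G)$ and diagonal degree matrix $D(G)$, and $\alpha\in[0,1]$, $A_\alpha(G)=\alpha D(G)+(1-\alpha)A(G)$; the $A_\alpha$-index $\lambda_\alpha(G)$ is its largest eigenvalue. The independence number is the maximum size of a set of pairwise non-adjacent vertices. For nonnegative integers $s,t,k$ with $\max\{s,t,k\}\geqslant1$ and $s+t+k=n-5$, $H_3(s,t,k)$ is the $n$-vertex tree obtained from the path $v_1v_4v_2v_5v_3$ by attaching $s$ pendant edges at $v_1$, $t$ pendant edges at $v_2$, and $k$ pendant edges at $v_3$. *)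

(* Defs.v *)
From HB Require Import structures.
From mathcomp Require Import all_boot all_order all_algebra.
From mathcomp Require Import complex polyrcf.
From mathcomp Require Import boolp classical_sets reals.
Set Implicit Arguments.
Unset Strict Implicit.
Unset Printing Implicit Defensive.
Import Order.TTheory GRing.Theory Num.Theory.
Local Open Scope ring_scope.

(* Finite simple graphs; connectedness is a separate predicate. *)
Record sgraph := SGraph {
  vertex :> finType;
  adj : rel vertex;
  adj_sym : symmetric adj;
  adj_irr : irreflexive adj }.

Definition connected (G : sgraph) : Prop := forall x y : G, connect (@adj G) x y.

Definition isomorphic (G H : sgraph) : Prop :=
  exists2 f : G -> H, bijective f & forall x y : G, adj (f x) (f y) = adj x y.

Definition independent (G : sgraph) (S : {set G}) : bool :=
  [forall x in S, forall y in S, ~~ adj x y].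

Definition independence_number (G : sgraph) : nat :=
  \max_(S : {set G} | independent S) #|S|.

Definition degree (G : sgraph) (x : G) : nat := #|[set y : G | adj x y]|.

Section Matrices.
Variables (R : realType) (G : sgraph).

(* Rows and columns are indexed through the enumeration of the vertices. *)
Definition adjacency_mx : 'M[R]_#|G| :=
  \matrix_(i, j) (adj (enum_val i : G) (enum_val j : G))%:R.

Definition degree_mx : 'M[R]_#|G| :=
  diag_mx (\row_i (degree (enum_val i : G))%:R).

Definition A_alpha (alpha : R) : 'M[R]_#|G| :=
  alpha *: degree_mx + (1 - alpha) *: adjacency_mx.

(* The matrix is real symmetric, so on a nonempty graph its set of real
   eigenvalues is finite and nonempty and this supremum is a maximum (A_index_max
   below). *)
Definition A_index (alpha : R) : R :=
  sup [set a : R | eigenvalue (A_alpha alpha) a]%classic.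

End Matrices.

(* The tree H_3(s,t,k). The path v1 v4 v2 v5 v3 is 0 - 1 - 2 - 3 - 4 in 'I_5,
   so that v1, v2, v3 are the positions 0, 2, 4; the summands 'I_s, 'I_t, 'I_k
   are the pendant vertices at v1, v2, v3. *)
Section H3.
Variables s t k : nat.

Definition H3_vertex : finType := ('I_5 + ('I_s + 'I_t + 'I_k))%type.

Definition H3_arc (x y : H3_vertex) : bool :=
  match x, y with
  | inl i, inl j => i.+1 == j :> nat
  | inl i, inr (inl (inl _)) => i == 0%N :> nat
  | inl i, inr (inl (inr _)) => i == 2%N :> nat
  | inl i, inr (inr _) => i == 4%N :> nat
  | _, _ => false
  end.

Definition H3_adj : rel H3_vertex := fun x y => H3_arc x y || H3_arc y x.

Lemma H3_adj_sym : symmetric H3_adj.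
Proof. by move=> x y; rewrite /H3_adj orbC. Qed.

Lemma H3_adj_irr : irreflexive H3_adj.
Proof.
move=> x; rewrite /H3_adj orbb.
by case: x => [i|[[]|]] //=; rewrite eqn_leq ltnn.
Qed.

Definition H3 : sgraph := SGraph H3_adj_sym H3_adj_irr.

End H3.

Lemma A_alpha_sym (R : realType) (G : sgraph) (alpha : R) :
  (A_alpha G alpha)^T = A_alpha G alpha.
Proof.
rewrite /A_alpha linearD !linearZ /= /degree_mx tr_diag_mx; congr (_ + _ *: _).
by apply/matrixP => i j; rewrite !mxE adj_sym.
Qed.

Lemma sym_eigenvalue_exists (R : rcfType) (n : nat) (A : 'M[R]_n) :
  (0 < n)%N -> A^T = A -> exists a : R, eigenvalue A a.
Proof.
move=> n_gt0 symA; pose f := @real_complex R.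
pose B := map_mx f A.
have szB : size (char_poly B) != 1%N by rewrite size_char_poly; case: (n) n_gt0.
have /closed_rootP [a] := szB.
rewrite -eigenvalue_root_char => Ba.
have [v vB v0] := eigenvalueP Ba.
suff areal : a \is Num.real.
  exists (complex.Re a).
  rewrite -(eigenvalue_map f).
  have /= -> := RRe_real areal; exact: Ba.
pose w := (map_mx Num.conj v)^T.
have Bw : B *m w = (Num.conj a) *: w.
  have /(congr1 (fun M => (map_mx Num.conj M)^T)) := vB.
  rewrite map_mxM trmx_mul -/w map_mxZ linearZ /= -/w => <-; congr (_ *m _).
  apply/matrixP => i j; rewrite !mxE -[in LHS]symA mxE.
  by apply/esym/CrealP/complex_realP; eexists.
have vw : (v *m w) 0 0 != 0.
  rewrite mxE psumr_neq0; last by move=> i _; rewrite !mxE mul_conjC_ge0.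
  have /rV0Pn [j vj] := v0.
  apply/hasP; exists j; first exact: mem_index_enum.
  by rewrite !mxE /= mul_conjC_gt0.
apply/CrealP/(mulIf vw).
transitivity ((v *m (B *m w)) 0 0); first by rewrite Bw -scalemxAr [RHS]mxE.
by rewrite mulmxA vB -scalemxAl [LHS]mxE.
Qed.

Lemma sym_eigenvalue_max (R : rcfType) (n : nat) (A : 'M[R]_n) :
  (0 < n)%N -> A^T = A ->
  exists2 m : R, eigenvalue A m & forall a, eigenvalue A a -> a <= m.
Proof.
move=> n_gt0 symA; have [a0 Aa0] := sym_eigenvalue_exists n_gt0 symA.
have p_neq0 : char_poly A != 0 by rewrite monic_neq0 // char_poly_monic.
pose s := rootsR (char_poly A).
have sE a : eigenvalue A a = (a \in s).
  by rewrite eigenvalue_root_char -(roots_on_rootsR p_neq0) in_itv.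
have s_gt0 : (index a0 s < size s)%N by rewrite index_mem -sE.
have [i _ imax] := arg_maxP (fun i : 'I_(size s) => s`_i)
  (isT : xpredT (Ordinal s_gt0)).
exists s`_i => [|a]; first by rewrite sE mem_nth.
rewrite sE => as_; have as_lt : (index a s < size s)%N by rewrite index_mem.
by have := imax (Ordinal as_lt) isT; rewrite /= nth_index.
Qed.

Lemma A_index_max (R : realType) (G : sgraph) (alpha : R) : (0 < #|G|)%N ->
  eigenvalue (A_alpha G alpha) (A_index G alpha) /\
  forall a, eigenvalue (A_alpha G alpha) a -> a <= A_index G alpha.
Proof.
move=> G_gt0.
have [m Am mmax] := sym_eigenvalue_max G_gt0 (A_alpha_sym G alpha).
suff -> : A_index G alpha = m by [].
apply/eqP; rewrite eq_le; apply/andP; split.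
  by apply: ge_sup => //; exists m.
by apply: ub_le_sup => //; exists m.
Qed.

(* Main.v *)
(** Deleting a maximum independent set leaves three vertices [a], [b], [c].
    Up to moving one edge at a time, each move lowering the [A_alpha]-index,
    [G] contains a spanning [H_3(s,t,k)], so an extremal [G] is such a tree.
    A move is analysed on the Perron vector [z] of the resulting graph: the
    quadratic form of the original graph is larger at [z] or at [z] with two
    entries exchanged.

    On [H_3(s,t,k)] the eigenvalue equations for [l] reduce to a tridiagonal
    3x3 system whose diagonal entries decrease by
    [g = alpha + (1-alpha)^2/(l-alpha)] per pendant vertex, with off-diagonal
    entry [h = (1-alpha)^2/(l-2*alpha)]. Convexity in the end entries balances
    [s] and [k]. If [alpha >= 1/2], then at the index of the target tree the end
    entry is smaller than [g]: one more pendant vertex at an end, or enough of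
    them in the middle, makes a diagonal entry nonpositive, and the finitely
    many remaining shapes differ by at most two moved pendant vertices. *)
Require Import Defs.
From mathcomp Require Import all_boot all_order all_algebra.
From mathcomp Require Import perm complex reals spectral sesquilinear.
From mathcomp Require Import zify ring lra.
Set Implicit Arguments.
Unset Strict Implicit.
Unset Printing Implicit Defensive.
Import Order.TTheory GRing.Theory Num.Theory.
Local Open Scope ring_scope.

(** * Positive semidefinite forms *)

(** Over [R[i]] the matrix is hermitian, hence unitarily diagonalisable. Its diagonal entries are
    real eigenvalues of [M], and in the rotated coordinates [y] the form is the sum of the
    [d_i * |y_i|^2]. *)
Lemma sym_psd (R : rcfType) (n : nat) (M : 'M[R]_n) (v : 'rV[R]_n) :
  M^T = M -> (forall a, eigenvalue M a -> 0 <= a) ->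
  0 <= (v *m M *m v^T) 0 0.
Proof.
move=> symM M_ge0; pose f := @real_complex R.
pose B := map_mx f M; pose P := spectralmx B; pose d := spectral_diag B.
have real_f k l (N : 'M[R]_(k, l)) : map_mx Num.conj (map_mx f N) = map_mx f N.
  by apply/matrixP => i j; rewrite !mxE; apply/CrealP/complex_realP; eexists.
have Bherm : B \is hermsymmx.
  by apply/is_hermitianmxP; rewrite expr0 scale1r map_trmx symM real_f.
have /orthomx_spectralP BE := hermitian_normalmx Bherm.
have PU : P \is unitarymx := spectral_unitarymx B.
have PB : P *m B = diag_mx d *m P.
  by rewrite {1}BE !mulmxA mulmxV ?mul1mx // spectral_unit.
have d_ge0 i : 0 <= d 0 i.
  have /mxOverP/(_ 0 i)/complex_realP [a da] := hermitian_spectral_diag_real Bherm.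
  rewrite [d 0 i]da -[0]/(0%:C)%C lecR M_ge0 // -(eigenvalue_map f).
  apply/eigenvalueP; exists (row i P).
    by rewrite -row_mul PB; apply/rowP => j; rewrite mul_diag_mx !mxE [d 0 i]da.
  (* A row of the unitary [P] has norm 1, hence is a nonzero eigenvector. *)
  apply/eqP => /(congr1 (fun w => w *m map_mx Num.conj w^T)).
  move=> /(congr1 (fun w : 'M_1 => w 0 0)); rewrite mul0mx !mxE.
  have /unitarymxP/matrixP/(_ i i) := PU; rewrite !mxE eqxx mulr1n => PPi.
  move=> Pi0; have /eqP := oner_neq0 R[i]; apply.
  by rewrite -[1]PPi -[RHS]Pi0; apply: eq_bigr => j _; rewrite !mxE.
rewrite -lecR; change (0 <= f ((v *m M *m v^T) 0 0)).
pose y := map_mx f v *m map_mx Num.conj P^T.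
suff -> : f ((v *m M *m v^T) 0 0) = \sum_i d 0 i * `|y 0 i| ^+ 2.
  apply: sumr_ge0 => i _; apply: mulr_ge0; first exact: d_ge0.
  by apply: exprn_ge0; apply: normr_ge0.
transitivity (map_mx f (v *m M *m v^T) 0 0); first by rewrite [RHS]mxE.
rewrite !map_mxM -/B BE -/P -/d invmx_unitary // !mulmxA -/y.
have -> : y *m diag_mx d *m P *m map_mx f v^T
          = y *m diag_mx d *m map_mx Num.conj y^T.
  rewrite -!mulmxA; congr (_ *m (_ *m _)).
  by rewrite trmx_mul map_mxM trmxCK map_trmx real_f.
rewrite mxE; apply: eq_bigr => i _; rewrite mul_mx_diag !mxE normCK.
by rewrite mulrAC mulrC mulrA.
Qed.

Lemma row_sqr_ge0 (R : rcfType) (n : nat) (u : 'rV[R]_n) :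
  0 <= (u *m u^T) 0 0.
Proof. by rewrite mxE sumr_ge0 // => i _; rewrite !mxE -expr2 sqr_ge0. Qed.

Lemma row_sqr_eq0 (R : rcfType) (n : nat) (u : 'rV[R]_n) :
  (u *m u^T) 0 0 = 0 -> u = 0.
Proof.
move=> uu; apply/rowP => i; rewrite [RHS]mxE; apply/eqP; rewrite -sqrf_eq0.
rewrite eq_le sqr_ge0 andbT -uu [X in _ <= X]mxE (bigD1 i) //= [u^T _ _]mxE.
rewrite -expr2 lerDl.
by apply: sumr_ge0 => j _; rewrite !mxE -expr2 sqr_ge0.
Qed.

(** A zero of a semidefinite form minimises it. Along the direction [u = v *m M] the form is
    [t^2 * q + 2 * t * p] with [p = |u|^2], which stays nonnegative for all [t] only if [p = 0]. *)
Lemma sym_psd_ker (R : rcfType) (n : nat) (M : 'M[R]_n) (v : 'rV[R]_n) :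
  M^T = M -> (forall a, eigenvalue M a -> 0 <= a) ->
  (v *m M *m v^T) 0 0 = 0 -> v *m M = 0.
Proof.
move=> symM M_ge0 vMv; pose u := v *m M.
apply: row_sqr_eq0; have uu0 := row_sqr_ge0 u.
have key t : 0 <= t * t * (u *m M *m u^T) 0 0 + 2 * t * (u *m u^T) 0 0.
  have := sym_psd (t *: u + v) symM M_ge0.
  rewrite linearD linearZ /= !mulmxDl !mulmxDr -!scalemxAl -!scalemxAr.
  have uT : u^T = M *m v^T by rewrite trmx_mul symM.
  have -> : v *m M *m u^T = u *m u^T by [].
  have -> : u *m M *m v^T = u *m u^T by rewrite uT mulmxA.
  move: vMv; set a := u *m M *m u^T; set b := u *m u^T; set c := v *m M *m v^T.
  have addE (x y : 'M[R]_1) : (x + y) 0 0 = x 0 0 + y 0 0 by rewrite mxE.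
  have scaleE k (x : 'M[R]_1) : (k *: x) 0 0 = k * x 0 0 by rewrite mxE.
  by move=> c0; rewrite !(addE, scaleE) c0; congr (0 <= _); ring.
move: (sym_psd u symM M_ge0) key uu0.
move: ((u *m M *m u^T) 0 0) ((u *m u^T) 0 0) => q p q0 key p0.
apply/eqP; rewrite eq_le p0 andbT leNgt; apply/negP => pp.
have q1 : 0 < q + 1 by lra.
(* The minimiser would be [- p / q]; the shift by 1 covers [q = 0]. *)
have := key (- p / (q + 1)).
have -> : - p / (q + 1) * (- p / (q + 1)) * q + 2 * (- p / (q + 1)) * p =
          - (p * p * (q + 2)) / ((q + 1) * (q + 1)).
  by field; rewrite gt_eqF.
rewrite mulNr oppr_ge0 leNgt divr_gt0 ?mulr_gt0 //; lra.
Qed.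

(** * Perron theory of A_alpha *)

Section AlphaOperator.
Variables (R : realType) (alpha : R).
Hypotheses (alpha_ge0 : 0 <= alpha) (alpha_lt1 : alpha < 1).

(* [alpha_op f] is the image of the column vector [f] under the matrix [A_alpha]. *)
Definition alpha_op (G : sgraph) (f : G -> R) (x : G) : R :=
  \sum_(y | adj x y) (alpha * f x + (1 - alpha) * f y).

Lemma alpha_op_ext (G : sgraph) (f g : G -> R) : f =1 g ->
  alpha_op f =1 alpha_op g.
Proof. by move=> fg x; apply: eq_bigr => y _; rewrite !fg. Qed.

Lemma alpha_opE (G : sgraph) (v : 'rV[R]_#|G|) (i : 'I_#|G|) :
  (v *m A_alpha G alpha) 0 i
  = alpha_op (fun x => v 0 (enum_rank x)) (enum_val i).
Proof.
rewrite mxE /alpha_op big_split /= sumr_const -mulr_sumr enum_valK.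
have -> : #|(fun y : G => adj (enum_val i) y)| = degree (enum_val i : G).
  by rewrite /degree cardsE.
transitivity (\sum_j ((j == i)%:R * (alpha * v 0 i * (degree (enum_val i : G))%:R)
    + (1 - alpha) * (v 0 j * (adj (enum_val i : G) (enum_val j))%:R))).
  apply: eq_bigr => j _; rewrite !mxE adj_sym.
  by have [->|_] := eqVneq j i; rewrite ?mulr1n ?mulr0n /=; ring.
rewrite big_split /= -mulr_suml -mulr_sumr; congr (_ + _ * _).
  rewrite (bigD1 i) //= eqxx big1 => [|j /negbTE->//].
  by rewrite addr0 mul1r mulr_natr.
rewrite [RHS]big_mkcond [RHS](reindex_onto enum_val enum_rank) => [|x _]; last first.
  exact: enum_rankK.
apply: eq_big => [j|j _]; first by rewrite enum_valK eqxx.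
by rewrite enum_valK; case: adj; rewrite ?mulr1 ?mulr0.
Qed.

Lemma alpha_op_sym (G : sgraph) (f g : G -> R) :
  \sum_x f x * alpha_op g x = \sum_x g x * alpha_op f x.
Proof.
have E (u w : G -> R) : \sum_x u x * alpha_op w x =
    \sum_x \sum_(y | adj x y) alpha * u x * w x
    + \sum_x \sum_(y | adj x y) (1 - alpha) * u x * w y.
  rewrite -big_split; apply: eq_bigr => x _.
  by rewrite mulr_sumr -big_split; apply: eq_bigr => y _ /=; ring.
rewrite !E; congr (_ + _).
  by apply: eq_bigr => x _; apply: eq_bigr => y _; ring.
rewrite (exchange_big_dep xpredT) //=; apply: eq_bigr => x _.
by apply: eq_big => [y|y _]; [rewrite adj_sym | ring].
Qed.

Section Rayleigh.
Variables (G : sgraph) (G_gt0 : (0 < #|G|)%N).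
Let rho := A_index G alpha.
Let M := rho%:M - A_alpha G alpha.

Let M_sym : M^T = M.
Proof. by rewrite linearB /= tr_scalar_mx A_alpha_sym. Qed.

Let M_ge0 a : eigenvalue M a -> 0 <= a.
Proof.
case/eigenvalueP => v vM v0.
have [_ rho_max] := A_index_max alpha G_gt0.
suff /rho_max : eigenvalue (A_alpha G alpha) (rho - a).
  by rewrite -/rho; lra.
apply/eigenvalueP; exists v => //; move: vM.
rewrite mulmxBr mul_mx_scalar scalerBl => <-.
by rewrite opprB addrC subrK.
Qed.

Let formE (f : G -> R) (v := \row_i f (enum_val i)) :
  (v *m M *m v^T) 0 0 = \sum_x f x * (rho * f x - alpha_op f x).
Proof.
rewrite mxE [RHS](reindex_onto enum_val enum_rank) => [|x _]; last first.
  exact: enum_rankK.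
apply: eq_big => [j|j _]; first by rewrite enum_valK eqxx.
rewrite mulmxBr mul_mx_scalar [v^T j 0]mxE mulrC; congr (_ * _); first by rewrite mxE.
rewrite [LHS]mxE; congr (_ + _); first by rewrite !mxE.
rewrite [LHS]mxE alpha_opE; congr (- _); apply: alpha_op_ext => x.
by rewrite mxE enum_rankK.
Qed.

Let gapE (f : G -> R) : \sum_x f x * (rho * f x - alpha_op f x) =
  rho * \sum_x f x ^+ 2 - \sum_x f x * alpha_op f x.
Proof. by rewrite mulr_sumr -sumrB; apply: eq_bigr => x _; ring. Qed.

(** [rho] is the largest eigenvalue, so [M] has no negative one and its form is semidefinite. *)
Lemma alpha_rayleigh (f : G -> R) :
  \sum_x f x * alpha_op f x <= rho * \sum_x f x ^+ 2.
Proof. by rewrite -subr_ge0 -gapE -formE; apply: sym_psd M_sym M_ge0. Qed.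

(** Equality case: the form of [M] vanishes at [f], so [f] lies in its kernel. *)
Lemma alpha_rayleigh_eq (f : G -> R) :
  rho * \sum_x f x ^+ 2 <= \sum_x f x * alpha_op f x ->
  forall x, alpha_op f x = rho * f x.
Proof.
move=> f_max x; pose v : 'rV[R]_#|G| := \row_i f (enum_val i).
have vM : v *m M = 0.
  apply: (sym_psd_ker M_sym M_ge0); rewrite formE gapE; apply/eqP.
  by rewrite subr_eq0 eq_le f_max alpha_rayleigh.
have /rowP/(_ (enum_rank x)) := vM; rewrite mulmxBr mul_mx_scalar.
rewrite [RHS]mxE [LHS]mxE [(- _ : 'rV_ _) _ _]mxE alpha_opE enum_rankK.
rewrite [in X in X - _]mxE [v _ _]mxE enum_rankK => /eqP; rewrite subr_eq0 => /eqP ->.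
by apply: alpha_op_ext => y; rewrite mxE enum_rankK.
Qed.

End Rayleigh.

(** At a zero of [f] the operator is a sum of nonnegative terms [(1 - alpha) * f w], so zeros spread
    along edges. *)
Lemma alpha_op_eq0 (G : sgraph) (f : G -> R) (x y : G) :
  (forall w, 0 <= f w) -> f x = 0 -> alpha_op f x <= 0 -> adj x y -> f y = 0.
Proof.
move=> f_ge0 fx opx xy; apply/eqP; rewrite eq_le f_ge0 andbT leNgt.
apply: contraL opx => fy; rewrite -ltNge /alpha_op (bigD1 y) //= fx.
rewrite ltr_wpDr ?sumr_ge0 // => [w _|]; last first.
  by rewrite mulr0 add0r mulr_gt0 // subr_gt0.
by rewrite mulr0 add0r mulr_ge0 // subr_ge0 ltW.
Qed.

Lemma connected_closed (G : sgraph) (P : pred G) (x : G) : connected G -> P x ->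
  (forall u w, P u -> adj u w -> P w) -> forall y, P y.
Proof.
move=> Gconn Px Padj y; have /connectP [p xp ->] := Gconn x y.
by elim: p x Px xp => //= w p IH x Px /andP [xw wp]; apply: IH wp; apply: Padj xw.
Qed.

(** Taking absolute values in an eigenvector for the index does not lower the form, so the result
    attains the Rayleigh bound and is again an eigenvector. A zero entry would spread to the whole
    connected graph. *)
Lemma perron (G : sgraph) : (0 < #|G|)%N -> connected G ->
  exists z : G -> R,
    (forall x, 0 < z x) /\ forall x, alpha_op z x = A_index G alpha * z x.
Proof.
move=> G_gt0 Gconn; have [/eigenvalueP [v vA v0] _] := A_index_max alpha G_gt0.
set rho := A_index G alpha in vA *.
pose f x := v 0 (enum_rank x); pose z x := `|f x|.
have fE x : alpha_op f x = rho * f x.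
  have /rowP/(_ (enum_rank x)) := vA.
  by rewrite alpha_opE enum_rankK [RHS]mxE.
have zE x : alpha_op z x = rho * z x.
  apply: alpha_rayleigh_eq => //.
  rewrite -/rho mulr_sumr; apply: ler_sum => {}x _.
  have -> : rho * z x ^+ 2 = f x * alpha_op f x.
    by rewrite fE /z real_normK ?num_real //; ring.
  rewrite /alpha_op !mulr_sumr; apply: ler_sum => y _.
  have := ler_norm (f x * f y); rewrite normrM -/(z x) -/(z y) => fz.
  have fx : f x * f x = z x * z x by rewrite -!expr2 real_normK ?num_real.
  rewrite !mulrDr !(mulrCA _ alpha) fx lerD2l !(mulrCA _ (1 - alpha)).
  by rewrite ler_wpM2l // subr_ge0 ltW.
exists z; split=> // x; rewrite lt0r normr_ge0 andbT.
apply: contra_neq v0 => zx; apply/rowP => j; rewrite [RHS]mxE; apply/eqP.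
rewrite -normr_eq0 -[j]enum_valK -[X in X == _]/(z (enum_val j)).
apply: (connected_closed (P := fun y => z y == 0) (x := x)) => //.
  exact/eqP.
move=> u w /eqP zu uw; apply/eqP; apply: (alpha_op_eq0 _ zu _ uw); last by rewrite zE zu mulr0.
by move=> w'; apply: normr_ge0.
Qed.

(* Below, pairing with the Perron vector [z] of [G] turns [\sum z (A f)] into
   [A_index G alpha * \sum z f]. *)
Lemma A_index_lt (G : sgraph) (lam : R) (f : G -> R) (x0 : G) : connected G ->
  (forall x, 0 <= f x) -> (forall x, alpha_op f x <= lam * f x) ->
  alpha_op f x0 < lam * f x0 -> A_index G alpha < lam.
Proof.
move=> Gconn f_ge0 f_le f_lt.
have [z [z_gt0 zE]] : exists z : G -> R, (forall x, 0 < z x) /\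
    forall x, alpha_op z x = A_index G alpha * z x.
  by apply: perron => //; apply/card_gt0P; exists x0.
have zf_ge0 : 0 <= \sum_x f x * z x.
  by apply: sumr_ge0 => x _; rewrite mulr_ge0 // ltW.
have : \sum_x z x * alpha_op f x < lam * \sum_x f x * z x.
  rewrite mulr_sumr (bigD1 x0) //= [X in _ < X](bigD1 x0) //=.
  apply: ltr_leD; first by rewrite mulrA mulrC ltr_pM2r.
  by apply: ler_sum => x _; rewrite mulrA mulrC ler_pM2r.
have -> : \sum_x z x * alpha_op f x = A_index G alpha * \sum_x f x * z x.
  rewrite alpha_op_sym mulr_sumr; apply: eq_bigr => x _.
  by rewrite zE mulrCA.
by rewrite !ltNge; apply: contra => lam_le; rewrite ler_wpM2r.
Qed.

Lemma A_index_gt (G : sgraph) (lam : R) (f : G -> R) (x0 : G) : connected G ->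
  (forall x, 0 <= f x) -> (forall x, lam * f x <= alpha_op f x) ->
  lam * f x0 < alpha_op f x0 -> lam < A_index G alpha.
Proof.
move=> Gconn f_ge0 f_le f_lt.
have [z [z_gt0 zE]] : exists z : G -> R, (forall x, 0 < z x) /\
    forall x, alpha_op z x = A_index G alpha * z x.
  by apply: perron => //; apply/card_gt0P; exists x0.
have zf_ge0 : 0 <= \sum_x f x * z x.
  by apply: sumr_ge0 => x _; rewrite mulr_ge0 // ltW.
have : lam * \sum_x f x * z x < \sum_x z x * alpha_op f x.
  rewrite mulr_sumr (bigD1 x0) //= [X in _ < X](bigD1 x0) //=.
  apply: ltr_leD; first by rewrite mulrA [X in _ < X]mulrC ltr_pM2r.
  by apply: ler_sum => x _; rewrite mulrA [X in _ <= X]mulrC ler_pM2r.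
have -> : \sum_x z x * alpha_op f x = A_index G alpha * \sum_x f x * z x.
  rewrite alpha_op_sym mulr_sumr; apply: eq_bigr => x _.
  by rewrite zE mulrCA.
by rewrite !ltNge; apply: contra => lam_le; rewrite ler_wpM2r.
Qed.

Lemma A_index_eq (G : sgraph) (lam : R) (f : G -> R) (x0 : G) : connected G ->
  (forall x, 0 < f x) -> (forall x, alpha_op f x = lam * f x) ->
  A_index G alpha = lam.
Proof.
move=> Gconn f_gt0 fE.
have [z [z_gt0 zE]] : exists z : G -> R, (forall x, 0 < z x) /\
    forall x, alpha_op z x = A_index G alpha * z x.
  by apply: perron => //; apply/card_gt0P; exists x0.
have zf_gt0 : 0 < \sum_x f x * z x.
  rewrite (bigD1 x0) //= ltr_wpDr ?mulr_gt0 ?sumr_ge0 // => x _.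
  by rewrite mulr_ge0 // ltW.
apply: (mulIf (lt0r_neq0 zf_gt0)); rewrite !mulr_sumr.
transitivity (\sum_x f x * alpha_op z x).
  by apply: eq_bigr => x _; rewrite zE mulrCA.
rewrite alpha_op_sym; apply: eq_bigr => x _.
by rewrite fE mulrCA (mulrC (f x)).
Qed.

Lemma connected_hom (G H : sgraph) (phi : H -> G) (psi : G -> H) :
  cancel psi phi -> (forall x y, adj x y -> adj (phi x) (phi y)) ->
  connected H -> connected G.
Proof.
move=> psiK phi_hom Hconn x y; rewrite -[x]psiK -[y]psiK.
apply: (connected_closed (x := psi x)
  (P := fun y => connect (@adj G) (phi (psi x)) (phi y))) => [||u w xu uw].
- exact: Hconn.
- exact: connect0.
- by apply: connect_trans xu (connect1 _); apply: phi_hom.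
Qed.

(* If the homomorphism is not an isomorphism, the Perron vector of [H]
   transported to [G] is strictly subharmonic somewhere. *)
Lemma A_index_hom (G H : sgraph) (phi : H -> G) : (0 < #|H|)%N ->
  connected H -> bijective phi ->
  (forall x y, adj x y -> adj (phi x) (phi y)) ->
  isomorphic G H \/ A_index H alpha < A_index G alpha.
Proof.
move=> H_gt0 Hconn [psi phiK psiK] phi_hom.
have [iso|] := boolP [forall x : H, forall y : H, adj (phi x) (phi y) ==> adj x y].
  left; exists psi; first by exists phi.
  move=> x y; rewrite -{2}[x]psiK -{2}[y]psiK; apply/idP/idP => [/phi_hom//|].
  by move/forallP/(_ (psi x))/forallP/(_ (psi y))/implyP: iso; apply.
rewrite negb_forall => /existsP [x0]; rewrite negb_forall => /existsP [y0].
rewrite negb_imply => /andP [gxy hxy]; right.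
have [z [z_gt0 zE]] := perron H_gt0 Hconn.
pose f x := z (psi x).
have term_gt0 x y : 0 < alpha * z x + (1 - alpha) * z y.
  by rewrite ltr_wpDl ?mulr_ge0 ?mulr_gt0 ?subr_gt0 // ltW.
have opE x : alpha_op f (phi x) =
    \sum_(y | adj (phi x) (phi y)) (alpha * z x + (1 - alpha) * z y).
  rewrite /alpha_op (reindex phi) /=; last by exists psi => y _.
  by apply: eq_bigr => y _; rewrite /f !phiK.
have diffE x : alpha_op f (phi x) = alpha_op z x +
    \sum_(y | adj (phi x) (phi y) && ~~ adj x y) (alpha * z x + (1 - alpha) * z y).
  rewrite opE (bigID (adj x)) /=; congr (_ + _); apply: eq_bigl => y.
  by case: (boolP (adj x y)) => [/phi_hom ->|]; rewrite ?andbF.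
apply: (@A_index_gt _ _ f (phi x0)).
- exact: connected_hom psiK phi_hom Hconn.
- by move=> x; rewrite ltW // z_gt0.
- move=> x; rewrite -[x]psiK diffE /f phiK zE lerDl sumr_ge0 // => y _.
  exact: ltW.
rewrite diffE /f phiK zE ltrDl (bigD1 y0) ?gxy //=.
by rewrite ltr_wpDr // sumr_ge0 // => y _; rewrite ltW.
Qed.

Lemma A_index_iso (G H : sgraph) : (0 < #|H|)%N -> connected H ->
  isomorphic G H -> A_index G alpha = A_index H alpha.
Proof.
move=> H_gt0 Hconn [psi [phi psiK phiK] psi_adj].
have [z [z_gt0 zE]] := perron H_gt0 Hconn.
have /card_gt0P [x0 _] := H_gt0.
apply: (@A_index_eq _ _ (fun x => z (psi x)) (phi x0)) => [|x|x].
- by apply: connected_hom psiK _ Hconn => x y; rewrite -psi_adj !phiK.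
- exact: z_gt0.
rewrite -zE /alpha_op [RHS](reindex psi) /=; last by exists phi => y _.
by apply: eq_bigl => y; rewrite psi_adj.
Qed.

(* Kelmans' transformation: [G] is obtained from [H] by rerouting to [u] the
   edges that join [w] to the set [D]. *)
Lemma A_index_reroute (G H : sgraph) (phi : H -> G) (D : pred H) (u w v : H)
  (z : H -> R) : (0 < #|H|)%N -> bijective phi ->
  (forall x, 0 < z x) -> (forall x, alpha_op z x = A_index H alpha * z x) ->
  (forall x y, adj (phi x) (phi y) + ((x == w) * D y + (y == w) * D x) =
     adj x y + ((x == u) * D y + (y == u) * D x))%N ->
  u != w -> ~~ D u -> ~~ D w -> D v -> z w <= z u ->
  A_index H alpha < A_index G alpha.
Proof.
move=> H_gt0 [psi phiK psiK] z_gt0 zE adjE u_w Du Dw Dv z_uw.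
have w_u : w != u by rewrite eq_sym.
pose f x := z (psi x); pose F x y := alpha * z x + (1 - alpha) * z y.
(* Compared with [H], the vertex [u] gains the terms over [D], [w] loses them, and each vertex of
   [D] trades [w] for [u]. *)
have opE x : alpha_op f (phi x) =
    alpha_op z x + ((x == u)%:R - (x == w)%:R) * \sum_(y | D y) F x y
    + (D x)%:R * (F x u - F x w).
  rewrite /alpha_op [LHS](reindex phi) /=; last by exists psi => y _.
  have -> : F x u - F x w = \sum_y ((y == u)%:R - (y == w)%:R) * F x y.
    rewrite (bigD1 u) //= eqxx (negbTE u_w) subr0 mul1r; congr (_ + _).
    rewrite (bigD1 w) //= eqxx (negbTE w_u) big1 ?addr0 => [|y].
      by rewrite sub0r mulN1r.
    by case/andP => /negbTE -> /negbTE ->; rewrite subrr mul0r.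
  transitivity (\sum_y ((adj x y)%:R * F x y
    + ((x == u)%:R - (x == w)%:R) * ((D y)%:R * F x y)
    + (D x)%:R * (((y == u)%:R - (y == w)%:R) * F x y))); last first.
    rewrite big_split /= -mulr_sumr; congr (_ + _).
    rewrite big_split /= -mulr_sumr; congr (_ + _ * _).
      by rewrite [RHS]big_mkcond; apply: eq_bigr => y _; case: adj;
        rewrite ?mul1r ?mul0r.
    by rewrite [RHS]big_mkcond; apply: eq_bigr => y _; case: (D y);
      rewrite ?mul1r ?mul0r.
  rewrite [LHS]big_mkcond; apply: eq_bigr => y _; rewrite /f !phiK -/(F x y).
  transitivity ((adj (phi x) (phi y))%:R * F x y).
    by case: adj; rewrite ?mul1r ?mul0r.
  have := congr1 (fun n => n%:R : R) (adjE x y); rewrite !natrD !natrM => e.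
  rewrite !mulrA -!mulrDl; congr (_ * _).
  by apply/eqP; rewrite -subr_eq0; apply/eqP; lra.
have F_gt0 x y : 0 < F x y.
  by rewrite ltr_wpDl ?mulr_ge0 ?mulr_gt0 ?subr_gt0 // ltW.
have sumE (h : R -> R -> R) : \sum_x h (f x) (alpha_op f x) =
    \sum_x h (z x) (alpha_op f (phi x)).
  rewrite [LHS](reindex phi) /=; last by exists psi => y _.
  by apply: eq_bigr => x _; rewrite /f phiK.
have G_gt0 : (0 < #|G|)%N by apply/card_gt0P; exists (phi u).
(* Each [y] in [D] raises the form by [(z u - z w) * (alpha * (z u + z w) + 2 * (1 - alpha) * z y)],
   which is nonnegative. *)
have form_ge : A_index H alpha * \sum_x f x ^+ 2 <= \sum_x f x * alpha_op f x.
  rewrite (sumE (fun a _ => a ^+ 2)) (sumE (fun a b => a * b)) mulr_sumr.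
  have -> : \sum_x z x * alpha_op f (phi x) =
      \sum_x A_index H alpha * z x ^+ 2
      + \sum_(y | D y) (z u * F u y - z w * F w y + z y * (F y u - F y w)).
    transitivity (\sum_x A_index H alpha * z x ^+ 2
      + \sum_x (((x == u)%:R - (x == w)%:R) * (z x * \sum_(y | D y) F x y)
      + (D x)%:R * (z x * (F x u - F x w)))).
      rewrite -big_split /=; apply: eq_bigr => x _; rewrite opE zE.
      set S := \sum_(y | D y) _; set d := F x u - _; ring.
    congr (_ + _); rewrite !big_split /=; congr (_ + _); last first.
      by rewrite [RHS]big_mkcond; apply: eq_bigr => x _; case: (D x);
        rewrite ?mul1r ?mul0r.
    rewrite (bigD1 u) //= eqxx (negbTE u_w) subr0 mul1r mulr_sumr; congr (_ + _).
    rewrite (bigD1 w) //= eqxx (negbTE w_u) [X in _ + X]big1 ?addr0 => [|y].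
      by rewrite sub0r mulN1r mulr_sumr -sumrN.
    by case/andP => /negbTE -> /negbTE ->; rewrite subrr mul0r.
  rewrite lerDl sumr_ge0 // => y _; rewrite /F.
  have [zu0 zw0 zy0] := And3 (z_gt0 u) (z_gt0 w) (z_gt0 y).
  have -> : z u * (alpha * z u + (1 - alpha) * z y)
      - z w * (alpha * z w + (1 - alpha) * z y)
      + z y * (alpha * z y + (1 - alpha) * z u
               - (alpha * z y + (1 - alpha) * z w))
    = (z u - z w) * (alpha * (z u + z w) + 2 * (1 - alpha) * z y) by ring.
  have beta_gt0 : 0 < 1 - alpha by rewrite subr_gt0.
  rewrite mulr_ge0 ?subr_ge0 // addr_ge0 // mulr_ge0 ?(ltW (addr_gt0 _ _)) //.
    by rewrite mulr_ge0 // ltW.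
  exact: ltW.
have f2 : 0 <= \sum_x f x ^+ 2 by apply: sumr_ge0 => x _; apply: sqr_ge0.
(* If the index did not grow, [f] would be an eigenvector of [G]; but at [u] the operator has
   strictly gained the terms over [D], which contains [v]. *)
rewrite ltNge; apply/negP => le_GH.
have /(_ (phi u)) : forall x, alpha_op f x = A_index G alpha * f x.
  by apply: alpha_rayleigh_eq => //; apply: le_trans form_ge; rewrite ler_wpM2r.
rewrite opE /f phiK zE eqxx (negbTE u_w) (negbTE Du) mul0r addr0 subr0 mul1r.
have SD : 0 < \sum_(y | D y) F u y.
  by rewrite (bigD1 v) //= ltr_wpDr // sumr_ge0 // => y _; rewrite ltW.
have := ler_wpM2r (ltW (z_gt0 u)) le_GH; lra.
Qed.

End AlphaOperator.

(** * Moving an edge *)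

Section MoveEdge.
Variables (G : sgraph) (u v p : G).

(* The edge [u v] is replaced by [p v]; the guard [x != y] only acts if [p = v]. *)
Definition move_edge_adj : rel G := fun x y =>
  (x != y) && ([|| (x == p) && (y == v), (x == v) && (y == p)
    | adj x y && ~~ ((x == u) && (y == v) || (x == v) && (y == u))]).

Lemma move_edge_sym : symmetric move_edge_adj.
Proof.
move=> x y; rewrite /move_edge_adj eq_sym adj_sym.
by case: (x == p); case: (y == v); case: (x == v); case: (y == p);
   case: (x == u); case: (y == u); rewrite ?andbF ?andbT ?orbF.
Qed.

Lemma move_edge_irr : irreflexive move_edge_adj.
Proof. by move=> x; rewrite /move_edge_adj eqxx. Qed.

Definition move_edge : sgraph := SGraph move_edge_sym move_edge_irr.

Hypotheses (p_v : p != v) (p_u : p != u) (uv : adj u v).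

Let u_v : u != v.
Proof. by apply: contraTneq uv => ->; rewrite adj_irr. Qed.


(** The lost edge [u v] is bypassed by the walk from [u] to [p] followed by the new edge [p v]. *)
Lemma move_edge_connected : connected G ->
  connect (@adj move_edge) u p -> connected move_edge.
Proof.
move=> Gconn up.
have csym : connect_sym (@adj move_edge) := sym_connect_sym (@adj_sym move_edge).
have pv : connect (@adj move_edge) p v.
  by apply: connect1; rewrite /= /move_edge_adj p_v !eqxx.
have uv' := connect_trans up pv.
move=> x; apply: (connected_closed (G := G) (x := x)) => //= a b xa ab.
apply: connect_trans xa _.
have [/andP [/eqP -> /eqP ->]//|nuv] := boolP ((a == u) && (b == v)).
have [/andP [/eqP -> /eqP ->]|nvu] := boolP ((a == v) && (b == u)).
  by rewrite csym.
apply: connect1; rewrite /= /move_edge_adj ab (negbTE nuv) (negbTE nvu) !orbT andbT.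
by apply: contraTneq ab => ->; rewrite adj_irr.
Qed.

(** The neighbours of [p] other than [u] are neighbours of [u], so the move hands the private
    neighbour [v] of [u] to [p] while [q] stays with [u]. The original graph keeps all private
    neighbours at one vertex, which gives the larger index whichever of [u] and [p] has the larger
    Perron entry. *)
Lemma A_index_move_edge (R : realType) (alpha : R) (q : G) :
  0 <= alpha -> alpha < 1 -> connected move_edge -> ~~ adj p v ->
  (forall y, adj p y -> y != u -> adj u y) ->
  adj u q -> ~~ adj p q -> q != v -> q != p ->
  A_index move_edge alpha < A_index G alpha.
Proof.
move=> a_ge0 a_lt1 Hconn pv p_sub_u uq pq qv qp.
have H_gt0 : (0 < #|move_edge|)%N by apply/card_gt0P; exists u.
have [z [z_gt0 zE]] := perron a_lt1 H_gt0 Hconn.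
have v_u : v != u by rewrite eq_sym.
have v_p : v != p by rewrite eq_sym.
have u_p : u != p by rewrite eq_sym.
have vu : adj v u by rewrite adj_sym.
have vp : adj v p = false by rewrite adj_sym (negbTE pv).
(* If [z p <= z u], moving the edge back raises the form at [z]. Otherwise,
   after exchanging [u] and [p], the graph [G] arises from [move_edge] by
   rerouting to [p] the private neighbours of [u] other than [v]. *)
have [z_pu|/ltW z_up] := lerP (z p) (z u).
  apply: (@A_index_reroute _ _ a_ge0 a_lt1 G move_edge id (pred1 v) u p v z) => //=.
    by exists id.
  move=> x y; rewrite /move_edge_adj.
  have [->|xy] := eqVneq x y.
    have [->|yv] := eqVneq y v; last by rewrite adj_irr !muln0.
    by rewrite adj_irr (negbTE v_u) (negbTE v_p).
  have [exv|xv] := eqVneq x v; have [eyv|yv] := eqVneq y v.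
  - by rewrite exv eyv eqxx in xy.
  - rewrite exv (negbTE v_u) (negbTE v_p) /= !muln0 !muln1 !add0n.
    have [->|yp] := eqVneq y p; first by rewrite vp (negbTE p_u).
    by have [->|yu] := eqVneq y u; rewrite /= ?vu ?andbT ?addn0.
  - rewrite eyv (negbTE v_u) (negbTE v_p) /= !muln0 !muln1 !addn0 !andbT.
    have [->|xp] := eqVneq x p; first by rewrite (negbTE pv) (negbTE p_u).
    by have [->|xu] := eqVneq x u; rewrite /= ?uv ?andbT ?addn0 ?orbF.
  - by rewrite !muln0 !andbF !addn0 /= andbT.
pose D y := [&& adj u y, ~~ adj p y, y != v & y != p].
have Du : D u = false by rewrite /D adj_irr.
have Dp : D p = false by rewrite /D eqxx !andbF.
apply: (@A_index_reroute _ _ a_ge0 a_lt1 G move_edge (tperm u p) D p u q z) => //=.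
- by exists (tperm u p); exact: tpermK.
- have other a b : a != u -> a != p -> b != u -> b != p ->
      move_edge_adj a b = adj a b.
    move=> au ap bu bp; rewrite /move_edge_adj (negbTE ap) (negbTE bp).
    rewrite (negbTE au) (negbTE bu) !andbF /= andbT.
    by have [->|] := eqVneq a b; rewrite ?adj_irr.
  have fromu y : y != u -> y != p -> (adj p y + D y = move_edge_adj u y)%N.
    move=> yu yp; rewrite /move_edge_adj /D (negbTE u_p) (negbTE u_v) yp eqxx /=.
    rewrite (eq_sym u y) (negbTE yu) /= ?andbF ?orbF /=.
    have [->|yv] := eqVneq y v; first by rewrite (negbTE pv) !andbF.
    rewrite /= andbT; case: (boolP (adj p y)) => [/p_sub_u -> //|_].
    by rewrite andbT.
  have fromp y : y != u -> y != p -> (adj u y = move_edge_adj p y + D y :> nat)%N.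
    move=> yu yp; rewrite /move_edge_adj /D (negbTE p_u) (negbTE p_v) eqxx /=.
    rewrite (eq_sym p y) (negbTE yp) /= ?andbF ?orbF ?andbT /=.
    have [->|yv] := eqVneq y v; first by rewrite uv andbF.
    by case: (boolP (adj p y)) => [/p_sub_u -> //|_]; rewrite /= andbT.
  have Hsym := move_edge_sym.
  have up : move_edge_adj u p = adj u p.
    by rewrite /move_edge_adj (negbTE u_p) (negbTE u_v) (negbTE p_v) (negbTE p_u)
      !andbF /= andbT.
  move=> x y.
  have [->|xu] := eqVneq x u; have [->|yu] := eqVneq y u;
    rewrite ?tpermL ?(negbTE u_p) ?Du ?mul0n ?mul1n ?muln0.
  + by rewrite adj_irr move_edge_irr.
  + have [->|yp] := eqVneq y p; first by rewrite tpermR Dp adj_sym up.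
    by rewrite tpermD // 1?eq_sym // !addn0 fromu.
  + have [->|xp] := eqVneq x p; first by rewrite tpermR Dp Hsym up.
    by rewrite tpermD // 1?eq_sym // !addn0 add0n Hsym -fromu // adj_sym.
  + have [->|xp] := eqVneq x p; have [->|yp] := eqVneq y p;
      rewrite ?tpermR ?Dp ?mul0n ?mul1n ?muln0 ?addn0.
    * by rewrite adj_irr move_edge_irr.
    * by rewrite tpermD // 1?eq_sym // fromp.
    * by rewrite tpermD // 1?eq_sym // add0n adj_sym fromp // Hsym.
    * by rewrite !tpermD // 1?eq_sym // other.
- by rewrite Dp.
- by rewrite Du.
- by rewrite /D uq pq qv qp.
Qed.

End MoveEdge.

(** * The trees H_3 *)

Section H3Tree.
Variables s t k : nat.

Lemma card_H3 : #|H3 s t k| = (5 + (s + t + k))%N.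
Proof. by rewrite /= !card_sum !card_ord. Qed.

Lemma H3_connected : connected (H3 s t k).
Proof.
pose r : H3 s t k := inl ord0.
have csym : connect_sym (@adj (H3 s t k)) := sym_connect_sym (@adj_sym _).
have path_conn (i : 'I_5) : connect (@adj (H3 s t k)) r (inl i).
  case: i => i; elim: i => [|i IH] i_lt.
    by rewrite (_ : Ordinal i_lt = ord0) ?connect0 //; apply: val_inj.
  apply: connect_trans (IH (ltnW i_lt)) (connect1 _).
  by rewrite /= /H3_adj /= eqxx.
have root_conn (x : H3 s t k) : connect (@adj (H3 s t k)) r x.
  case: x => [//|[[i|i]|i]].
  - exact: connect_trans (path_conn ord0) (connect1 _).
  - exact: connect_trans (path_conn (@Ordinal 5 2 isT)) (connect1 _).
  - exact: connect_trans (path_conn (@Ordinal 5 4 isT)) (connect1 _).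
by move=> x y; apply: (connect_trans _ (root_conn y)); rewrite csym.
Qed.

End H3Tree.

(** Each of three disjoint edges has an end outside any independent set. *)
Lemma independence_number_matching (G : sgraph) (a1 b1 a2 b2 a3 b3 : G) :
  adj a1 b1 -> adj a2 b2 -> adj a3 b3 -> uniq [:: a1; b1; a2; b2; a3; b3] ->
  (independence_number G <= #|G| - 3)%N.
Proof.
move=> e1 e2 e3 U; apply/bigmax_leqP => S /forall_inP indS.
have pick_out a b : adj a b -> exists2 c, c \notin S & (c == a) || (c == b).
  move=> ab; have [aS|aS] := boolP (a \in S); last by exists a; rewrite ?eqxx.
  exists b; last by rewrite eqxx orbT.
  by apply: contraL ab => bS; have /forall_inP := indS a aS; apply.
have [c1 c1S c1E] := pick_out _ _ e1.
have [c2 c2S c2E] := pick_out _ _ e2.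
have [c3 c3S c3E] := pick_out _ _ e3.
have Uc : uniq [:: c1; c2; c3].
  move: U; rewrite /= !inE !negb_or !andbT -!andbA.
  do 14![case/andP => ?]; move=> ?.
  by case/orP: c1E => /eqP ->; case/orP: c2E => /eqP ->; case/orP: c3E => /eqP ->;
    apply/and3P.
have : (#|[set x in [:: c1; c2; c3]]| <= #|~: S|)%N.
  apply: subset_leq_card; apply/subsetP => x; rewrite !inE.
  by case/or3P => /eqP ->.
rewrite cardsE (card_uniqP Uc) [#|~: S|]cardsCs setCK => le3.
by rewrite leq_subRL ?(leq_trans le3 (leq_subr _ _)) // addnC -leq_subRL ?max_card.
Qed.

(** A pendant vertex supplies the third edge of a matching, wherever it is attached; conversely,
    deleting the three attachment vertices leaves an independent set. *)
Lemma H3_independence (s t k : nat) : (0 < s + t + k)%N ->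
  independence_number (H3 s t k) = (#|H3 s t k| - 3)%N.
Proof.
pose v i : (i < 5)%N -> H3 s t k := fun lt_i => inl (Ordinal lt_i).
pose v0 := v 0 isT; pose v1 := v 1 isT; pose v2 := v 2 isT.
pose v3 := v 3 isT; pose v4 := v 4 isT.
move=> stk_gt0; apply/eqP; rewrite eqn_leq; apply/andP; split.
  have [s0|s_gt0] := posnP s; last first.
    pose p : H3 s t k := inr (inl (inl (Ordinal s_gt0))).
    exact: (@independence_number_matching (H3 s t k) v0 p v1 v2 v3 v4).
  have [t0|t_gt0] := posnP t; last first.
    pose p : H3 s t k := inr (inl (inr (Ordinal t_gt0))).
    exact: (@independence_number_matching (H3 s t k) v0 v1 v2 p v3 v4).
  have k_gt0 : (0 < k)%N by lia.
  pose p : H3 s t k := inr (inr (Ordinal k_gt0)).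
  exact: (@independence_number_matching (H3 s t k) v0 v1 v2 v3 v4 p).
pose S : {set H3 s t k} := ~: [set x in [:: v0; v2; v4]].
have -> : (#|H3 s t k| - 3)%N = #|S|.
  by rewrite cardsCs setCK cardsE (card_uniqP _).
apply: (leq_bigmax_cond (P := fun S => independent S) (F := fun S => #|S|)).
apply/forall_inP => x xS; apply/forall_inP => y; move: xS; rewrite !inE.
case: x => [[[|[|[|[|[|x]]]]] //= ?]|[[x|x]|x]];
  by case: y => [[[|[|[|[|[|y]]]]] //= ?]|[[y|y]|y]].
Qed.

(** Each vertex off the path is hung on the first of [v1], [v2], [v3] adjacent to it; the sizes of
    the three classes are [s], [t], [k]. The other edges of [G] are ignored, so the bijection only
    preserves adjacency in one direction. *)
Lemma H3_embedding (G : sgraph) (v1 v4 v2 v5 v3 : G) :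
  uniq [:: v1; v4; v2; v5; v3] ->
  adj v1 v4 -> adj v4 v2 -> adj v2 v5 -> adj v5 v3 ->
  (forall x, x \notin [:: v1; v4; v2; v5; v3] ->
     [|| adj x v1, adj x v2 | adj x v3]) ->
  exists s t k : nat, (s + t + k = #|G| - 5)%N /\
    exists2 phi : H3 s t k -> G, bijective phi &
      forall x y, adj x y -> adj (phi x) (phi y).
Proof.
set vs := [:: v1; v4; v2; v5; v3] => U e1 e2 e3 e4 rest.
pose O : {set G} := [set x | x \notin vs].
pose S := [set x in O | adj x v1].
pose T := [set x in O | ~~ adj x v1 & adj x v2].
pose K := [set x in O | ~~ adj x v1 & ~~ adj x v2].
have O_card : (#|S| + #|T| + #|K| = #|G| - 5)%N.
  have <- : #|O| = (#|G| - 5)%N.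
    by rewrite cardsCs [~: O](_ : _ = [set x in vs]) ?cardsE ?(card_uniqP U) //;
      apply/setP => x; rewrite !(in_set, in_setD, in_setI, in_setC) negbK.
  rewrite -(cardsID [set x | adj x v1] O) -addnA; congr (_ + _)%N.
    by congr #|pred_of_set _|; apply/setP => x; rewrite !(in_set, in_setD, in_setI, in_setC).
  rewrite -(cardsID [set x | adj x v2] (O :\: _)); congr (_ + _)%N;
    by congr #|pred_of_set _|; apply/setP => x; rewrite !(in_set, in_setD, in_setI, in_setC);
      case: (x \in vs); case: (adj x v1); case: (adj x v2).
exists #|S|, #|T|, #|K|; split=> //.
pose phi (x : H3 #|S| #|T| #|K|) : G := match x with
  | inl i => nth v1 vs i
  | inr (inl (inl i)) => enum_val i
  | inr (inl (inr i)) => enum_val i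
  | inr (inr i) => enum_val i
  end.
have SP (i : 'I_#|S|) : (enum_val i \notin vs) * adj (enum_val i) v1.
  by have := enum_valP i; rewrite !(in_set, in_setD, in_setI, in_setC) => /andP [].
have TP (i : 'I_#|T|) : (enum_val i \notin vs) * (adj (enum_val i) v1 = false)
    * adj (enum_val i) v2.
  by have := enum_valP i; rewrite !(in_set, in_setD, in_setI, in_setC) => /and3P [? /negbTE].
have KP (i : 'I_#|K|) : (enum_val i \notin vs) * (adj (enum_val i) v1 = false)
    * (adj (enum_val i) v2 = false) * adj (enum_val i) v3.
  have := enum_valP i; rewrite !(in_set, in_setD, in_setI, in_setC) => /and3P [iO /negbTE i1 /negbTE i2].
  by have := rest _ iO; rewrite i1 i2.
have in_vs (i : 'I_5) : nth v1 vs i \in vs by rewrite mem_nth.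
exists phi.
  have card_phi : #|H3 #|S| #|T| #|K| | = #|G|.
    (* Five distinct vertices make the truncated [#|G| - 5] exact. *)
    have := max_card (mem vs); rewrite card_H3 (card_uniqP U) O_card /=; lia.
  apply: inj_card_bij; last by rewrite card_phi.
  have out x y : x \in vs -> y \notin vs -> x <> y.
    by move=> xv /negP yv xy; rewrite -xy in yv.
  have nei (x y w : G) : adj x w = false -> adj y w -> x <> y.
    by move=> xw yw xy; rewrite -xy xw in yw.
  move=> [i|[[i|i]|i]] [j|[[j|j]|j]] //= E.
  - congr inl; apply/ord_inj/eqP.
    by rewrite -(nth_uniq v1 (s := vs)) ?E ?ltn_ord.
  - by case: (out _ _ (in_vs i) (SP j).1).
  - by case: (out _ _ (in_vs i) (TP j).1.1).
  - by case: (out _ _ (in_vs i) (KP j).1.1.1).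
  - by case: (out _ _ (in_vs j) (SP i).1).
  - by rewrite (enum_val_inj E).
  - by case: (nei _ _ v1 (TP j).1.2 (SP i).2).
  - by case: (nei _ _ v1 (KP j).1.1.2 (SP i).2).
  - by case: (out _ _ (in_vs j) (TP i).1.1).
  - by case: (nei _ _ v1 (TP i).1.2 (SP j).2).
  - by rewrite (enum_val_inj E).
  - by case: (nei _ _ v2 (KP j).1.2 (TP i).2).
  - by case: (out _ _ (in_vs j) (KP i).1.1.1).
  - by case: (nei _ _ v1 (KP i).1.1.2 (SP j).2).
  - by case: (nei _ _ v2 (KP i).1.2 (TP j).2).
  - by rewrite (enum_val_inj E).
have phi_arc x y : H3_arc x y -> adj (phi x) (phi y).
  case: x => [i|//]; case: y => [j|[[j|j]|j]] /=.
  - by case: i => [[|[|[|[|[|i]]]]] ? //=]; case: j => [[|[|[|[|[|j]]]]] ? //=].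
  - by move/eqP => ->; rewrite /= adj_sym (SP j).
  - by move/eqP => ->; rewrite /= adj_sym (TP j).
  - by move/eqP => ->; rewrite /= adj_sym (KP j).
by move=> x y /orP [] /phi_arc //; rewrite adj_sym.
Qed.

(** * The index of [H3] through a tridiagonal 3x3 system *)

Section H3Index.
Variables (R : realType) (alpha : R).
Hypotheses (alpha_ge0 : 0 <= alpha) (alpha_lt1 : alpha < 1).

Section Tree.
Variables s t k : nat.
Local Notation H := (H3 s t k).

Definition H3_path (i : nat) : H := inl (inord i).

Let c1 := H3_path 0.
Let c4 := H3_path 1.
Let c2 := H3_path 2.
Let c5 := H3_path 3.
Let c3 := H3_path 4.
Let p1 (i : 'I_s) : H := inr (inl (inl i)).
Let p2 (i : 'I_t) : H := inr (inl (inr i)).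
Let p3 (i : 'I_k) : H := inr (inr i).

Lemma H3_ind (P : H -> Prop) : P c1 -> P c4 -> P c2 -> P c5 -> P c3 ->
  (forall i, P (p1 i)) -> (forall i, P (p2 i)) -> (forall i, P (p3 i)) ->
  forall x, P x.
Proof.
move=> P1 P4 P2 P5 P3 Q1 Q2 Q3 [j|[[j|j]|j]]; [|exact: Q1|exact: Q2|exact: Q3].
rewrite -[j]inord_val.
by case: j => [[|[|[|[|[|j]]]]] ?].
Qed.

Lemma H3_op (f : H -> R) (F := fun x y => alpha * f x + (1 - alpha) * f y) :
  [/\ alpha_op alpha f c1 = F c1 c4 + \sum_i F c1 (p1 i),
      alpha_op alpha f c2 = F c2 c4 + F c2 c5 + \sum_i F c2 (p2 i)
    & alpha_op alpha f c3 = F c3 c5 + \sum_i F c3 (p3 i)] /\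
  [/\ alpha_op alpha f c4 = F c4 c1 + F c4 c2,
      alpha_op alpha f c5 = F c5 c2 + F c5 c3,
      forall i, alpha_op alpha f (p1 i) = F (p1 i) c1,
      forall i, alpha_op alpha f (p2 i) = F (p2 i) c2
    & forall i, alpha_op alpha f (p3 i) = F (p3 i) c3].
Proof.
have sum5 (E : 'I_5 -> R) : \sum_i E i =
    E (inord 0) + E (inord 1) + E (inord 2) + E (inord 3) + E (inord 4).
  rewrite !big_ord_recl big_ord0 addr0 !addrA.
  by congr (_ + _ + _ + _ + _); congr E; apply: ord_inj; rewrite inordK.
have opE x : alpha_op alpha f x =
    (if adj x c1 then F x c1 else 0) + (if adj x c4 then F x c4 else 0)
    + (if adj x c2 then F x c2 else 0) + (if adj x c5 then F x c5 else 0)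
    + (if adj x c3 then F x c3 else 0)
    + \sum_(i | adj x (p1 i)) F x (p1 i) + \sum_(i | adj x (p2 i)) F x (p2 i)
    + \sum_(i | adj x (p3 i)) F x (p3 i).
  rewrite /alpha_op !big_sumType /= !addrA; congr (_ + _ + _ + _).
  rewrite [LHS]big_mkcond; apply: etrans (sum5 _) _.
  by [].
split; split=> *; rewrite opE /= /H3_adj /= ?inordK //= ?big_pred0_eq;
  rewrite ?(addr0, add0r) //.
Qed.

End Tree.

Local Notation beta := (1 - alpha).

(* Eliminating the pendant vertices and [v4], [v5] from the eigenvalue equations
   for [l] leaves the system
     [end_coef l s * y1 = link_weight l * y2],
     [mid_coef l t * y2 = link_weight l * (y1 + y3)],
     [end_coef l k * y3 = link_weight l * y2]
   for the values [y1], [y2], [y3] at [v1], [v2], [v3]. *)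
Definition pendant_weight (l : R) := alpha + beta ^+ 2 / (l - alpha).
Definition link_weight (l : R) := beta ^+ 2 / (l - 2 * alpha).
Definition end_coef (l : R) (s : nat) :=
  l - alpha - s%:R * pendant_weight l - link_weight l.
Definition mid_coef (l : R) (t : nat) :=
  l - 2 * alpha - t%:R * pendant_weight l - 2 * link_weight l.

(** The values at [v4], [v5] and the pendant vertices solve the eigenvalue equations for [l] there,
    so only the equations at [v1], [v2], [v3] can fail. *)
Definition H3_vector (s t k : nat) (l y1 y2 y3 : R) (x : H3 s t k) : R :=
  match x with
  | inl i => nth 0 [:: y1; beta * (y1 + y2) / (l - 2 * alpha); y2;
                       beta * (y2 + y3) / (l - 2 * alpha); y3] i
  | inr (inl (inl _)) => beta * y1 / (l - alpha)
  | inr (inl (inr _)) => beta * y2 / (l - alpha)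
  | inr (inr _) => beta * y3 / (l - alpha)
  end.

Lemma H3_vector_op (s t k : nat) (l y1 y2 y3 : R)
  (f := @H3_vector s t k l y1 y2 y3) : 2 * alpha < l ->
  [/\ alpha_op alpha f (H3_path s t k 0)
       = l * y1 - (end_coef l s * y1 - link_weight l * y2),
      alpha_op alpha f (H3_path s t k 2)
       = l * y2 - (mid_coef l t * y2 - link_weight l * (y1 + y3)),
      alpha_op alpha f (H3_path s t k 4)
       = l * y3 - (end_coef l k * y3 - link_weight l * y2)
    & forall x, x \notin [:: H3_path s t k 0; H3_path s t k 2; H3_path s t k 4] ->
        alpha_op alpha f x = l * f x].
Proof.
move=> l_gt; have [[E1 E2 E3] [E4 E5 Q1 Q2 Q3]] := H3_op f.
have l2 : l - 2 * alpha != 0 by rewrite gt_eqF // subr_gt0.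
have l1 : l - alpha != 0 by apply: lt0r_neq0; move: alpha_ge0; lra.
split.
- rewrite E1 /= !inordK //= sumr_const card_ord -mulr_natl.
  by rewrite /end_coef /pendant_weight /link_weight; field; rewrite ?l1 ?l2.
- rewrite E2 /= !inordK //= sumr_const card_ord -mulr_natl.
  by rewrite /mid_coef /pendant_weight /link_weight; field; rewrite ?l1 ?l2.
- rewrite E3 /= !inordK //= sumr_const card_ord -mulr_natl.
  by rewrite /end_coef /pendant_weight /link_weight; field; rewrite ?l1 ?l2.
elim/H3_ind.
- by rewrite !inE eqxx.
- by move=> _; rewrite E4 /= !inordK //=; field.
- by rewrite !inE eqxx orbT.
- by move=> _; rewrite E5 /= !inordK //=; field.
- by rewrite !inE eqxx !orbT.
- by move=> i _; rewrite Q1 /= !inordK //=; field.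
- by move=> i _; rewrite Q2 /= !inordK //=; field.
- by move=> i _; rewrite Q3 /= !inordK //=; field.
Qed.

Lemma H3_vector_ge0 (s t k : nat) (l y1 y2 y3 : R) (x : H3 s t k) :
  2 * alpha < l -> 0 <= y1 -> 0 <= y2 -> 0 <= y3 -> 0 <= H3_vector l y1 y2 y3 x.
Proof.
move=> l_gt y1_ge0 y2_ge0 y3_ge0.
have l2 : 0 <= l - 2 * alpha by lra.
have l1 : 0 <= l - alpha by move: alpha_ge0; lra.
have b_ge0 : 0 <= beta by rewrite subr_ge0 ltW.
case: x => [[[|[|[|[|[|i]]]]] ?]|[[i|i]|i]] //=;
  by apply: divr_ge0 => //; apply: mulr_ge0 => //; apply: addr_ge0.
Qed.

(** With [y2 = 1], the end values [h / end_coef] solve both end equations exactly, and the last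
    hypothesis makes the vector strictly superharmonic at [v2]. *)
Lemma H3_index_lt (s t k : nat) (l : R) : 2 * alpha < l ->
  0 < end_coef l s -> 0 < end_coef l k ->
  link_weight l ^+ 2 * (end_coef l s + end_coef l k)
    < mid_coef l t * (end_coef l s * end_coef l k) ->
  A_index (H3 s t k) alpha < l.
Proof.
move=> l_gt es ek mid_gt; set h := link_weight l in mid_gt.
have h_ge0 : 0 <= h by rewrite divr_ge0 ?sqr_ge0 //; lra.
pose f := @H3_vector s t k l (h / end_coef l s) 1 (h / end_coef l k).
have [E1 E2 E3 Eo] := @H3_vector_op s t k l (h / end_coef l s) 1 (h / end_coef l k) l_gt.
have es0 := lt0r_neq0 es; have ek0 := lt0r_neq0 ek.
have mid_lt : alpha_op alpha f (H3_path s t k 2) < l * f (H3_path s t k 2).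
  rewrite E2 /= inordK //= mulr1 gtrBl subr_gt0 -/h.
  have -> : h * (h / end_coef l s + h / end_coef l k)
      = h ^+ 2 * (end_coef l s + end_coef l k) / (end_coef l s * end_coef l k).
    by field; rewrite ?es0 ?ek0.
  by rewrite ltr_pdivrMr ?mulr_gt0 // mulr1.
apply: (A_index_lt alpha_lt1 (f := f) _ _ _ mid_lt).
- exact: H3_connected.
- by move=> x; apply: H3_vector_ge0 => //; apply: divr_ge0 => //; apply: ltW.
move=> x; have [|/Eo ->//] := boolP (x \in [:: H3_path s t k 0; H3_path s t k 2; H3_path s t k 4]).
rewrite !inE => /or3P [] /eqP ->; last 1 first.
- by rewrite E3 /= inordK //= [end_coef l k * _]mulrC divfK // mulr1 subrr subr0.
- by rewrite E1 /= inordK //= [end_coef l s * _]mulrC divfK // mulr1 subrr subr0.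
exact: ltW.
Qed.

(** For positive end coefficients the test vector of [H3_index_lt] is now strictly subharmonic at
    [v2]. If an end coefficient is nonpositive, it suffices to take 1 at that end and 0 at the two
    other centres: the defect at [v2] comes from the positive link weight. *)
Lemma H3_index_gt (s t k : nat) (l : R) : 2 * alpha < l ->
  [\/ end_coef l s <= 0, end_coef l k <= 0 |
    [/\ 0 < end_coef l s, 0 < end_coef l k &
      mid_coef l t * (end_coef l s * end_coef l k)
      < link_weight l ^+ 2 * (end_coef l s + end_coef l k)]] ->
  l < A_index (H3 s t k) alpha.
Proof.
move=> l_gt.
suff sub y1 y2 y3 : 0 <= y1 -> 0 <= y2 -> 0 <= y3 ->
    end_coef l s * y1 <= link_weight l * y2 ->
    end_coef l k * y3 <= link_weight l * y2 ->
    mid_coef l t * y2 < link_weight l * (y1 + y3) ->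
    l < A_index (H3 s t k) alpha.
  have h_gt0 : 0 < link_weight l.
    by rewrite divr_gt0 ?exprn_gt0 ?subr_gt0.
  case=> [es|ek|[es ek mid_lt]].
  - by apply: (sub 1 0 0); rewrite ?mulr0 ?mulr1 ?addr0 ?mulr1 ?ler01.
  - by apply: (sub 0 0 1); rewrite ?mulr0 ?mulr1 ?add0r ?mulr1 ?ler01.
  have es0 := lt0r_neq0 es; have ek0 := lt0r_neq0 ek.
  apply: (sub (link_weight l / end_coef l s) 1 (link_weight l / end_coef l k)).
  - by apply: divr_ge0; apply: ltW.
  - exact: ler01.
  - by apply: divr_ge0; apply: ltW.
  - by rewrite mulrCA mulfV.
  - by rewrite mulrCA mulfV.
  set h := link_weight l in mid_lt *.
  have -> : h * (h / end_coef l s + h / end_coef l k)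
      = h ^+ 2 * (end_coef l s + end_coef l k) / (end_coef l s * end_coef l k).
    by field; rewrite ?es0 ?ek0.
  by rewrite mulr1 ltr_pdivlMr ?mulr_gt0.
move=> y1_ge0 y2_ge0 y3_ge0 le1 le3 lt2.
have [E1 E2 E3 Eo] := @H3_vector_op s t k l y1 y2 y3 l_gt.
apply: (A_index_gt alpha_lt1 (f := @H3_vector s t k l y1 y2 y3)
  (x0 := H3_path s t k 2)).
- exact: H3_connected.
- by move=> x; apply: H3_vector_ge0.
- move=> x; have [|/Eo ->//] := boolP (x \in [:: H3_path s t k 0; H3_path s t k 2; H3_path s t k 4]).
  rewrite !inE => /or3P [] /eqP ->.
  + by rewrite E1 /= inordK //= lerBrDr gerDl subr_le0.
  + by rewrite E2 /= inordK //= lerBrDr gerDl subr_le0 ltW.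
  + by rewrite E3 /= inordK //= lerBrDr gerDl subr_le0.
by rewrite E2 /= inordK //= ltrBrDr gtrDl subr_lt0.
Qed.

(** Elimination in the Perron equations. Positive entries force [2 * alpha < l] through the equation
    at [v4] and positive end coefficients through those at [v1] and [v3]; the last equation says
    that the determinant of the 3x3 system vanishes. *)
Lemma H3_index_eq (s t k : nat) (l := A_index (H3 s t k) alpha) :
  [/\ 2 * alpha < l, 0 < end_coef l s, 0 < end_coef l k &
    mid_coef l t * (end_coef l s * end_coef l k)
      = link_weight l ^+ 2 * (end_coef l s + end_coef l k)].
Proof.
have H_gt0 : (0 < #|H3 s t k|)%N by rewrite card_H3.
have [z [z_gt0 zE]] := perron alpha_lt1 H_gt0 (@H3_connected s t k).
have [[E1 E2 E3] [E4 E5 Q1 Q2 Q3]] := H3_op z.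
rewrite !zE -/l in E1 E2 E3 E4 E5.
set y1 := z (H3_path s t k 0) in E1 E4 Q1.
set y2 := z (H3_path s t k 2) in E2 E4 E5 Q2.
set y3 := z (H3_path s t k 4) in E3 E5 Q3.
set x4 := z (H3_path s t k 1) in E1 E2 E4.
set x5 := z (H3_path s t k 3) in E2 E3 E5.
have [y1_gt0 y2_gt0 y3_gt0] := And3 (z_gt0 _ : 0 < y1) (z_gt0 _ : 0 < y2) (z_gt0 _ : 0 < y3).
have x4_gt0 : 0 < x4 := z_gt0 _.
have b_gt0 : 0 < beta by rewrite subr_gt0.
have l_gt : 2 * alpha < l.
  rewrite -subr_gt0 -(pmulr_lgt0 _ x4_gt0).
  have -> : (l - 2 * alpha) * x4 = beta * (y1 + y2) by rewrite mulrBl E4; ring.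
  by rewrite mulr_gt0 // addr_gt0.
have l2 : l - 2 * alpha != 0 by rewrite gt_eqF // subr_gt0.
have l1 : l - alpha != 0 by apply: lt0r_neq0; move: alpha_ge0; lra.
have x4E : x4 = beta * (y1 + y2) / (l - 2 * alpha).
  by apply: (mulIf l2); rewrite divfK // mulrC mulrBl E4; ring.
have x5E : x5 = beta * (y2 + y3) / (l - 2 * alpha).
  by apply: (mulIf l2); rewrite divfK // mulrC mulrBl E5; ring.
have leaf x y : l * x = alpha * x + beta * y -> x = beta * y / (l - alpha).
  by move=> e; apply: (mulIf l1); rewrite divfK // mulrC mulrBl e; ring.
have {}Q1 i : z (inr (inl (inl i))) = beta * y1 / (l - alpha).
  by apply: leaf; rewrite -Q1 zE.
have {}Q2 i : z (inr (inl (inr i))) = beta * y2 / (l - alpha).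
  by apply: leaf; rewrite -Q2 zE.
have {}Q3 i : z (inr (inr i)) = beta * y3 / (l - alpha).
  by apply: leaf; rewrite -Q3 zE.
have {}E1 : end_coef l s * y1 = link_weight l * y2.
  move: E1; rewrite (eq_bigr (fun=> alpha * y1 + beta * (beta * y1 / (l - alpha))));
    last by move=> i _; rewrite Q1.
  rewrite sumr_const card_ord -mulr_natl x4E => E1.
  rewrite /end_coef !mulrBl E1 /pendant_weight /link_weight.
  by field; rewrite ?l1 ?l2.
have {}E3 : end_coef l k * y3 = link_weight l * y2.
  move: E3; rewrite (eq_bigr (fun=> alpha * y3 + beta * (beta * y3 / (l - alpha))));
    last by move=> i _; rewrite Q3.
  rewrite sumr_const card_ord -mulr_natl x5E => E3.
  rewrite /end_coef !mulrBl E3 /pendant_weight /link_weight.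
  by field; rewrite ?l1 ?l2.
have {}E2 : mid_coef l t * y2 = link_weight l * (y1 + y3).
  move: E2; rewrite (eq_bigr (fun=> alpha * y2 + beta * (beta * y2 / (l - alpha))));
    last by move=> i _; rewrite Q2.
  rewrite sumr_const card_ord -mulr_natl x4E x5E => E2.
  rewrite /mid_coef !mulrBl E2 /pendant_weight /link_weight.
  by field; rewrite ?l1 ?l2.
have h_gt0 : 0 < link_weight l by rewrite divr_gt0 ?exprn_gt0 ?subr_gt0.
split=> //.
- by rewrite -(pmulr_lgt0 _ y1_gt0) E1 mulr_gt0.
- by rewrite -(pmulr_lgt0 _ y3_gt0) E3 mulr_gt0.
apply: (mulIf (lt0r_neq0 y2_gt0)).
transitivity (mid_coef l t * y2 * end_coef l s * end_coef l k); first by ring.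
rewrite E2.
transitivity (link_weight l * (end_coef l s * y1 * end_coef l k
  + end_coef l k * y3 * end_coef l s)); first by ring.
by rewrite E1 E3; ring.
Qed.

End H3Index.

(** * Comparison of the trees [H3] of a given order *)

Lemma shift_cases (s0 t0 s t k : nat) : (s0 <= t0 + 3)%N ->
  (s + t + k = s0 + t0 + s0)%N -> (s <= k + 1)%N -> (k <= s + 1)%N ->
  (s <= s0)%N -> (k <= s0)%N -> (t < s0)%N -> (s, t, k) != (s0, t0, s0) ->
  [\/ [/\ t = t0.+1, s = s0 & k.+1 = s0], [/\ t = t0.+1, s.+1 = s0 & k = s0]
    | [/\ t = t0.+2, s.+1 = s0 & k.+1 = s0]].
Proof.
move=> s0_le stk sk ks s_le k_le t_lt neq.
(* Equal totals with [s, k <= s0] give [t0 <= t], and [t < s0 <= t0 + 3] gives [t <= t0 + 2]. *)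
have [t1|[t2|t3]] : t = t0 \/ (t = t0.+1 \/ t = t0.+2) by lia.
- by case/eqP: neq; congr (_, _, _); lia.
- have [s1|s1] := eqVneq s s0; first by apply: Or31; split=> //; lia.
  by apply: Or32; split=> //; lia.
- by apply: Or33; split=> //; lia.
Qed.

Section H3Optimal.
Variables (R : realType) (alpha : R).
Hypotheses (alpha_ge0 : 0 <= alpha) (alpha_lt1 : alpha < 1).

Local Notation g := (pendant_weight alpha).
Local Notation h := (link_weight alpha).
Local Notation e := (end_coef alpha).
Local Notation m := (mid_coef alpha).

Lemma weights_bounds (l : R) : 2 * alpha < l ->
  [/\ alpha < g l, 0 < h l, g l - alpha <= h l
    & h l * (l - 2 * alpha) = (1 - alpha) ^+ 2].
Proof.
move=> l_gt; have a0 := alpha_ge0.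
have l2 : 0 < l - 2 * alpha by lra.
have l1 : 0 < l - alpha by lra.
have b_gt0 : 0 < (1 - alpha) ^+ 2 by rewrite exprn_gt0 // subr_gt0.
split.
- by rewrite /g ltrDl divr_gt0.
- exact: divr_gt0.
- rewrite /g /h addrC addKr ler_wpM2l ?(ltW b_gt0) // lef_pV2 ?posrE //; lra.
- by rewrite /h divfK // lt0r_neq0.
Qed.

Lemma end_coefB (l : R) (s k : nat) :
  e l s = e l k + (k%:R - s%:R) * g l.
Proof. by rewrite /end_coef; ring. Qed.

Lemma mid_coefB (l : R) (t r : nat) :
  m l t = m l r + (r%:R - t%:R) * g l.
Proof. by rewrite /mid_coef; ring. Qed.

Lemma mid_end_coef (l : R) (s t : nat) :
  m l t = e l s + (s%:R - t%:R) * g l - alpha - h l.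
Proof. by rewrite /mid_coef /end_coef; ring. Qed.

(** [E - G] and [K] are the end coefficients before a pendant vertex changes ends, [E] and [K - G]
    those after. Their sum is kept and their product grows by [G * (K - E)]. *)
Lemma shift_pendant_ineq (G H E K M : R) : 0 < G -> 0 < M -> E + G <= K ->
  M * ((E - G) * K) = H ^+ 2 * (E - G + K) ->
  H ^+ 2 * (E + (K - G)) < M * (E * (K - G)).
Proof.
move=> G_gt0 M_gt0 EK eqM.
have -> : E + (K - G) = E - G + K by ring.
rewrite -eqM ltr_pM2l // -subr_gt0.
have -> : E * (K - G) - (E - G) * K = G * (K - E) by ring.
by apply: mulr_gt0 => //; lra.
Qed.

(** At the index [l] of the less balanced tree the determinant vanishes and the middle coefficient
    is positive, so [shift_pendant_ineq] puts the balanced tree in the scope of [H3_index_lt] at the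
    same [l]. *)
Lemma H3_balance (s t k : nat) : (k < s)%N ->
  A_index (H3 s t k.+1) alpha < A_index (H3 s.+1 t k) alpha.
Proof.
move=> ks; have [] := H3_index_eq alpha_ge0 alpha_lt1 s.+1 t k.
set l := A_index _ _; move=> l_gt; have [ag h0 _ _] := weights_bounds l_gt.
have g0 := le_lt_trans alpha_ge0 ag.
have ks1 : k%:R + 1 <= s%:R :> R by rewrite natr1 ler_nat.
have eS n : e l n.+1 = e l n - g l by rewrite (end_coefB l n.+1 n) -natr1; ring.
have ek : e l s + g l <= e l k.
  rewrite (end_coefB l k s) lerD2l -{1}[g l]mul1r ler_pM2r //; lra.
rewrite eS => es_gt0 ek_gt0 midE.
have mid_gt0 : 0 < m l t.
  rewrite -(pmulr_lgt0 _ (mulr_gt0 es_gt0 ek_gt0)) midE.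
  by apply: mulr_gt0; [apply: exprn_gt0 | apply: addr_gt0].
apply: H3_index_lt => //; rewrite ?eS; [lra|lra|].
exact: shift_pendant_ineq midE.
Qed.

Lemma H3_balance_sym (s t k : nat) : (s < k)%N ->
  A_index (H3 s.+1 t k) alpha < A_index (H3 s t k.+1) alpha.
Proof.
move=> sk; have [] := H3_index_eq alpha_ge0 alpha_lt1 s t k.+1.
set l := A_index _ _; move=> l_gt; have [ag h0 _ _] := weights_bounds l_gt.
have g0 := le_lt_trans alpha_ge0 ag.
have sk1 : s%:R + 1 <= k%:R :> R by rewrite natr1 ler_nat.
have eS n : e l n.+1 = e l n - g l by rewrite (end_coefB l n.+1 n) -natr1; ring.
have es : e l k + g l <= e l s.
  rewrite (end_coefB l s k) lerD2l -{1}[g l]mul1r ler_pM2r //; lra.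
rewrite eS => es_gt0 ek_gt0; rewrite mulrC [e l s + _]addrC [e l s * _]mulrC mulrC => midE.
have mid_gt0 : 0 < m l t.
  rewrite -(pmulr_lgt0 _ (mulr_gt0 ek_gt0 es_gt0)) midE.
  by apply: mulr_gt0; [apply: exprn_gt0 | apply: addr_gt0].
apply: H3_index_lt => //; rewrite ?eS; [lra|lra|].
rewrite addrC [X in _ < _ * X]mulrC.
exact: shift_pendant_ineq midE.
Qed.

(** One pendant vertex of a symmetric tree moves from an end to the middle. Substituting
    [H^2 = M * a / 2], the two sides differ by [a * G * (2 * (a + G) - M) / 2]. *)
Lemma shift_end_ineq (G H a M : R) : 0 < G -> 0 < a -> M * a = 2 * H ^+ 2 ->
  M < 2 * (a + G) -> (M - G) * (a * (a + G)) < H ^+ 2 * (a + (a + G)).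
Proof.
move=> G0 a0 Ma M_lt; have -> : H ^+ 2 = M * a / 2 by rewrite Ma; field.
rewrite -subr_gt0 (_ : _ - _ = a * G * (2 * (a + G) - M) / 2); last by field.
by rewrite divr_gt0 // mulr_gt0 ?subr_gt0 // mulr_gt0.
Qed.

(** Here each end gives one pendant vertex to the middle, and the difference is
    [(a + G) * G * (2 * (a + G) - M)]. *)
Lemma shift_ends_ineq (G H a M : R) : 0 < G -> 0 < a -> M * a = 2 * H ^+ 2 ->
  M < 2 * (a + G) ->
  (M - 2 * G) * ((a + G) * (a + G)) < H ^+ 2 * (a + G + (a + G)).
Proof.
move=> G0 a0 Ma M_lt; have -> : H ^+ 2 = M * a / 2 by rewrite Ma; field.
rewrite -subr_gt0 (_ : _ - _ = (a + G) * G * (2 * (a + G) - M)); last by field.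
by rewrite mulr_gt0 ?subr_gt0 // mulr_gt0 // addr_gt0.
Qed.

(* [a], [M] are the end and middle coefficients of a symmetric tree at its index. *)
Lemma end_coef_lt_pendant (G H a M c d : R) : alpha <= G -> 1 - alpha <= alpha ->
  0 < H -> 0 < G -> 2 <= c -> 1 <= d ->
  H * (a + H + c * G - alpha) = (1 - alpha) ^+ 2 ->
  M = a + (d - 1) * G + G - alpha - H -> M * a = 2 * H ^+ 2 -> a < G.
Proof.
(* If [G <= a], then [alpha <= G <= a] and [1 - alpha <= G] give [H * (H + 2 * G) <= G^2], hence
   [2 * H < G]. But [M >= G - H] and [M * a = 2 * H^2] give [(G - 2 * H) * (G + H) <= 0], a
   contradiction. *)
move=> aG ba H0 G0 c2 d1 Hb ME Ma; rewrite ltNge; apply/negP => Ga.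
have b0 : 0 <= 1 - alpha by have := alpha_lt1; lra.
have bG : (1 - alpha) ^+ 2 <= G ^+ 2 by rewrite ler_sqr ?nnegrE; lra.
have HG : H * (H + 2 * G) <= G ^+ 2.
  apply: le_trans bG; rewrite -Hb ler_pM2l //; nra.
have M_ge : G - H <= M by nra.
have HG2 : 2 * H < G by rewrite ltNge; apply/negP => ?; nra.
have : (G - H) * G <= M * a by apply: ler_pM => //; lra.
have : 0 < (G - 2 * H) * (G + H) by apply: mulr_gt0; lra.
rewrite Ma; nra.
Qed.

Section Target.
Variables s0 t0 : nat.
Hypotheses (half_le : 2^-1 <= alpha) (s0_ge2 : (2 <= s0)%N) (t0_lt : (t0 < s0)%N).
Let l := A_index (H3 s0 t0 s0) alpha.

(** For equal ends the determinant equation has the end coefficient as a common factor, which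
    cancels. The bound by [g l] means that one more pendant vertex at an end makes its coefficient
    negative. *)
Lemma H3_target_coefs : [/\ 2 * alpha < l, 0 < e l s0 < g l, 0 < h l,
   m l t0 * e l s0 = 2 * h l ^+ 2
 & m l t0 = e l s0 + (s0%:R - t0%:R - 1) * g l + g l - alpha - h l].
Proof.
have [] := H3_index_eq alpha_ge0 alpha_lt1 s0 t0 s0.
rewrite -/l => l_gt a_gt0 _; have [ag h0 _ hb] := weights_bounds l_gt.
have g0 := le_lt_trans alpha_ge0 ag.
set a := e l s0 in a_gt0 * => midE.
have Ma : m l t0 * a = 2 * h l ^+ 2.
  by apply: (mulIf (lt0r_neq0 a_gt0)); rewrite -mulrA midE; ring.
have ME : m l t0 = a + (s0%:R - t0%:R - 1) * g l + g l - alpha - h l.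
  by rewrite (mid_end_coef l s0 t0) -/a; ring.
split=> //; rewrite a_gt0 /=.
have s2 : 2 <= s0%:R :> R by rewrite ler_nat.
have t1 : t0%:R + 1 <= s0%:R :> R by rewrite natr1 ler_nat.
apply: (end_coef_lt_pendant (H := h l) (M := m l t0) (c := s0%:R) (d := s0%:R - t0%:R)) => //.
- exact: ltW.
- by have := half_le; lra.
- by lra.
- by rewrite -hb /a /end_coef; ring.
Qed.

(** [H3_index_gt] is applied at the index [l] of the target: too many pendant vertices at an end or
    in the middle spoil the sign of a coefficient, and [shift_cases] lists the rest. *)
Lemma H3_target_gt (s t k : nat) : (s0 <= t0 + 3)%N ->
  (s + t + k = s0 + t0 + s0)%N -> (s <= k + 1)%N -> (k <= s + 1)%N ->
  (s, t, k) != (s0, t0, s0) -> l < A_index (H3 s t k) alpha.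
Proof.
move=> s0_le stk sk ks neq.
have [l_gt /andP [a_gt0 ag] h0 Ma ME] := H3_target_coefs.
have [alg _ dh _] := weights_bounds l_gt.
have g0 := le_lt_trans alpha_ge0 alg.
apply: H3_index_gt => //.
have e_le0 n : (s0 < n)%N -> e l n <= 0.
  move=> n_gt; rewrite (end_coefB l n s0).
  have : s0%:R + 1 <= n%:R :> R by rewrite natr1 ler_nat.
  nra.
have [s_gt|s_le] := ltnP s0 s; first by apply: Or31; apply: e_le0.
have [k_gt|k_le] := ltnP s0 k; first by apply: Or32; apply: e_le0.
have e_gt0 n : (n <= s0)%N -> 0 < e l n.
  move=> n_le; rewrite (end_coefB l n s0).
  have : n%:R <= s0%:R :> R by rewrite ler_nat.
  nra.
have es := e_gt0 _ s_le; have ek := e_gt0 _ k_le.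
apply: Or33; split=> //.
have [t_ge|t_lt] := leqP s0 t.
  (* For [s0 <= t] the middle coefficient is at most [e l s0 - alpha - h l], which is below
     [g l - alpha - h l <= 0]. *)
  apply: (@le_lt_trans _ _ 0); last first.
    by apply: mulr_gt0; [apply: exprn_gt0 | apply: addr_gt0].
  apply: mulr_le0_ge0; last by apply: mulr_ge0; apply: ltW.
  rewrite (mid_coefB l t t0) ME.
  have : s0%:R <= t%:R :> R by rewrite ler_nat.
  nra.
(* From [s0 - t0 <= 3] the left side is at most [e l s0 + 3 * g l - alpha - h l], and
   [g l - alpha <= h l]. *)
have M_lt : m l t0 < 2 * (e l s0 + g l).
  rewrite ME; have : s0%:R <= t0%:R + 3 :> R by rewrite -natrD ler_nat.
  nra.
have eS n : n.+1 = s0 -> e l n = e l s0 + g l.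
  by move=> <-; rewrite (end_coefB l n n.+1) -natr1; ring.
have M1 : m l t0.+1 = m l t0 - g l by rewrite (mid_coefB l t0.+1 t0) -natr1; ring.
have M2 : m l t0.+2 = m l t0 - 2 * g l.
  by rewrite (mid_coefB l t0.+2 t0) -!natr1; ring.
have [[-> -> ke]|[-> se ->]|[-> se ke]] := shift_cases s0_le stk sk ks s_le k_le t_lt neq.
- by rewrite M1 (eS _ ke); apply: shift_end_ineq.
- rewrite M1 (eS _ se) [(_ + _) * e l s0]mulrC [_ + e l s0]addrC.
  exact: shift_end_ineq.
- by rewrite M2 (eS _ se) (eS _ ke); apply: shift_ends_ineq.
Qed.

End Target.
End H3Optimal.

(** * Graphs with a vertex cover of size three *)

(* {a, b, c} is the complement of a maximum independent set; the last clause is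
   maximality. *)
Definition cover3 (G : sgraph) (a b c : G) : Prop :=
  [/\ uniq [:: a; b; c],
      forall x y, x \notin [:: a; b; c] -> y \notin [:: a; b; c] -> ~~ adj x y
    & forall x, x \in [:: a; b; c] ->
        exists2 y, y \notin [:: a; b; c] & adj x y].

Lemma cover3_perm (G : sgraph) (a b c a' b' c' : G) :
  perm_eq [:: a; b; c] [:: a'; b'; c'] -> cover3 a b c -> cover3 a' b' c'.
Proof.
move=> pabc [U ind out]; have memE := perm_mem pabc; split.
- by rewrite -(perm_uniq pabc).
- by move=> x y; rewrite -!memE; apply: ind.
move=> x; rewrite -memE => /out [y yout xy].
by exists y; rewrite -?memE.
Qed.

Lemma cover3_swap (G : sgraph) (a b c : G) : cover3 a b c -> cover3 b a c.
Proof. by apply: cover3_perm; rewrite (perm_catCA [:: a] [:: b] [:: c]). Qed.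

Lemma cover3_rot (G : sgraph) (a b c : G) : cover3 a b c -> cover3 b c a.
Proof. by apply: cover3_perm; rewrite perm_sym (perm_rot 1 [:: a; b; c]). Qed.

Lemma move_edge_far (G : sgraph) (u v p x y : G) : x \notin [:: u; v; p] ->
  @adj (move_edge u v p) x y = adj x y.
Proof.
rewrite !inE !negb_or => /and3P [xu xv xp]; rewrite /= /move_edge_adj.
rewrite (negbTE xu) (negbTE xv) (negbTE xp) /= andbT.
by have [->|] := eqVneq x y; rewrite ?adj_irr.
Qed.

Section Structure.
Variables (R : realType) (alpha : R).
Hypotheses (alpha_ge0 : 0 <= alpha) (alpha_lt1 : alpha < 1).

(** The goal of the reduction. For a graph of minimum index the strict alternative is excluded, so
    the graph itself is such a tree. *)
Definition H3_below (G : sgraph) : Prop :=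
  exists s t k : nat, (s + t + k = #|G| - 5)%N /\
    (isomorphic G (H3 s t k) \/ A_index (H3 s t k) alpha < A_index G alpha).

Lemma H3_below_embedding (G : sgraph) (v1 v4 v2 v5 v3 : G) :
  uniq [:: v1; v4; v2; v5; v3] ->
  adj v1 v4 -> adj v4 v2 -> adj v2 v5 -> adj v5 v3 ->
  (forall x, x \notin [:: v1; v4; v2; v5; v3] ->
     [|| adj x v1, adj x v2 | adj x v3]) ->
  H3_below G.
Proof.
move=> U e1 e2 e3 e4 rest.
have [s [t [k [stk [phi phi_bij phi_hom]]]]] := H3_embedding U e1 e2 e3 e4 rest.
exists s, t, k; split=> //; apply: A_index_hom phi_bij phi_hom => //.
- by rewrite card_H3.
- exact: H3_connected.
Qed.

(** Allows replacing [G] by the result of an index-lowering move; if that result is itself a tree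
    [H3], the move supplies the strict inequality. *)
Lemma H3_below_lt (G G' : sgraph) : #|G'| = #|G| ->
  A_index G' alpha < A_index G alpha -> H3_below G' -> H3_below G.
Proof.
move=> cardE lt_G' [s [t [k [stk H3G']]]]; exists s, t, k.
rewrite -cardE; split=> //; right; case: H3G' => [iso|lt_H3]; last first.
  exact: lt_trans lt_G'.
rewrite -(A_index_iso alpha_lt1 _ (@H3_connected s t k) iso) //.
by rewrite card_H3.
Qed.

Lemma exists_neighbor (G : sgraph) (x y : G) : connected G -> x != y ->
  exists z, adj x z.
Proof.
move=> Gconn; have /connectP [[|z p] /= xp ->] := Gconn x y; first by rewrite eqxx.
by move=> _; exists z; case/andP: xp.
Qed.

Section Cover.
Variable G : sgraph.
Hypotheses (Gconn : connected G) (G_card : (9 <= #|G|)%N).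

Lemma cover3_adj (a b c x : G) : cover3 a b c -> x \notin [:: a; b; c] ->
  [|| adj x a, adj x b | adj x c].
Proof.
case=> _ ind _ xout.
have xa : x != a by apply: contraNneq xout => ->; rewrite mem_head.
have [y xy] := exists_neighbor Gconn xa.
have /negPn : ~~ (y \notin [:: a; b; c]).
  by apply: contraL xy => /(ind _ _ xout).
by rewrite !inE => /or3P [] /eqP <-; rewrite xy ?orbT.
Qed.

(** The path is [a w b w' c]; every further vertex has a neighbour in the cover. *)
Lemma H3_below_two_links (a b c w w' : G) : cover3 a b c ->
  w \notin [:: a; b; c] -> w' \notin [:: a; b; c] -> w != w' ->
  adj w a -> adj w b -> adj w' b -> adj w' c -> H3_below G.
Proof.
move=> cov wout w'out ww' wa wb w'b w'c.
have [U _ _] := cov.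
apply: (@H3_below_embedding G a w b w' c) => //; rewrite 1?adj_sym //.
  move: U wout w'out; rewrite /= !inE !negb_or !andbT -!andbA.
  case/and3P=> ab ac bc /and3P [wa' wb' wc'] /and3P [w'a w'b' w'c'].
  by rewrite eq_sym wa' ab (eq_sym a w') w'a ac wb' ww' wc' (eq_sym b w') w'b' bc w'c'.
move=> x; rewrite !inE !negb_or => /and5P [xa _ xb _ xc].
by apply: cover3_adj => //; rewrite !inE !negb_or xa xb.
Qed.

(** If [r] meets [a] or [c], there are two links. Otherwise [r] is pendant at [b], and replacing the
    edge [w c] by [r c] creates the path [a w b r c]. *)
Lemma H3_below_center (a b c w r : G) : cover3 a b c ->
  w \notin [:: a; b; c] -> r \notin [:: a; b; c] -> w != r ->
  adj w a -> adj w b -> adj w c -> adj r b -> H3_below G.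
Proof.
move=> cov wout rout wr wa wb wc rb; have [U ind _] := cov.
have [ra|ra] := boolP (adj r a).
  by apply: (H3_below_two_links cov rout wout) => //; rewrite eq_sym.
have [rc|rc] := boolP (adj r c).
  exact: (H3_below_two_links cov wout rout).
move: (U) (wout) (rout); rewrite /= !inE !negb_or !andbT -!andbA.
case/and3P=> ab ac bc /and3P [wa' wb' wc'] /and3P [ra' rb' rc'].
have rw : r != w by rewrite eq_sym.
have [aw bw br] : [/\ adj a w, adj b w & adj b r] by split; rewrite adj_sym.
pose G' := move_edge w c r.
have far x y : x \notin [:: w; c; r] -> @adj G' x y = adj x y.
  exact: move_edge_far.
have a_far : a \notin [:: w; c; r].
  by rewrite !inE !negb_or (eq_sym a w) wa' ac (eq_sym a r) ra'.
have b_far : b \notin [:: w; c; r].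
  by rewrite !inE !negb_or (eq_sym b w) wb' bc (eq_sym b r) rb'.
have aw1 : @adj G' a w by rewrite far.
have wb1 : @adj G' w b by rewrite (@adj_sym G') far.
have br1 : @adj G' b r by rewrite far.
have rc1 : @adj G' r c by rewrite /= /move_edge_adj rc' !eqxx.
have mconn : connected G'.
  apply: move_edge_connected => //.
  exact: connect_trans (connect1 wb1) (connect1 br1).
have lt_index : A_index G' alpha < A_index G alpha.
  apply: (@A_index_move_edge G w c r rc' rw wc R alpha a) => //; try by rewrite eq_sym.
  move=> y ry _; have /negPn : ~~ (y \notin [:: a; b; c]).
    by apply: contraL ry => /(ind _ _ rout).
  by rewrite !inE => /or3P [] /eqP ->.
apply: H3_below_lt lt_index _ => //.
apply: (@H3_below_embedding G' a w b r c) => //.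
  by rewrite /= !inE !negb_or (eq_sym a w) wa' ab (eq_sym a r) ra' ac wb' wr wc'
    (eq_sym b r) rb' bc rc'.
move=> x; rewrite !inE !negb_or => /and5P [xa xw xb xr xc].
have x_far : x \notin [:: w; c; r] by rewrite !inE !negb_or xw xc.
by rewrite !far //; apply: cover3_adj => //; rewrite !inE !negb_or xa xb.
Qed.

(** The pendant vertex [p] at [u] is drawn into the edge [u v], which becomes the path [u p v]; [q]
    is the neighbour that stays with [u]. *)
Lemma move_leg (u v p q : G) (G' := move_edge u v p) :
  adj u v -> adj p u -> p != v -> (forall y, adj p y -> y = u) ->
  adj q u -> q != v -> q != p ->
  [/\ connected G', A_index G' alpha < A_index G alpha,
      @adj G' p u & @adj G' p v].
Proof.
move=> uv pu pv p_leaf qu qv qp.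
have uq : adj u q by rewrite adj_sym.
have p_u : p != u by apply: contraTneq pu => ->; rewrite adj_irr.
have u_v : u != v by apply: contraTneq uv => ->; rewrite adj_irr.
have u_p : u != p by rewrite eq_sym.
have v_u : v != u by rewrite eq_sym.
have pu1 : @adj G' p u.
  rewrite /= /move_edge_adj p_u pu (negbTE p_u) (negbTE pv) (negbTE u_v).
  by rewrite !andbF /= ?orbT.
have pv1 : @adj G' p v by rewrite /= /move_edge_adj pv !eqxx.
have G'conn : connected G'.
  apply: move_edge_connected => //; apply: connect1.
  by rewrite (@adj_sym G').
split=> //; apply: (@A_index_move_edge G u v p pv p_u uv R alpha q) => //.
- by apply/negP => /p_leaf vu; rewrite vu eqxx in v_u.
- by move=> y /p_leaf ->; rewrite eqxx.
by apply/negP => /p_leaf qeu; rewrite qeu adj_irr in qu.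
Qed.

Lemma cover3_leaf (a b c p y : G) : cover3 a b c -> p \notin [:: a; b; c] ->
  ~~ adj p b -> ~~ adj p c -> adj p y -> y = a.
Proof.
move=> [_ ind _] pout pb pc py; have /negPn : ~~ (y \notin [:: a; b; c]).
  by apply: contraL py => /(ind _ _ pout).
rewrite !inE => /or3P [] /eqP ye //; move: py; rewrite ye.
  by rewrite (negbTE pb).
by rewrite (negbTE pc).
Qed.

(** Unless [p] gives a second link, it is pendant at [a]. If [a] has another neighbour outside the
    cover, [move_leg] produces the path [a p b w c]; if not, [p a b w c] already works, with [a] in
    the role of [v4], since the remaining vertices meet [b] or [c]. *)
Lemma H3_below_leg (a b c w p : G) : cover3 a b c ->
  w \notin [:: a; b; c] -> p \notin [:: a; b; c] ->
  adj w b -> adj w c -> ~~ adj w a -> adj a b -> adj p a -> H3_below G.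
Proof.
move=> cov wout pout wb wc wa ab pa; have [U ind _] := cov.
have pw : p != w by apply: contraNneq wa => <-.
have [pb|pb] := boolP (adj p b).
  exact: (H3_below_two_links cov pout wout).
have [pc|pc] := boolP (adj p c).
  have cov' : cover3 a c b := cover3_rot (cover3_swap cov).
  have E x : (x \notin [:: a; c; b]) = (x \notin [:: a; b; c]).
    by rewrite !inE [(x == c) || _]orbC.
  by apply: (H3_below_two_links cov' _ _ pw) => //; rewrite E.
have p_leaf y : adj p y -> y = a by apply: cover3_leaf cov pout pb pc.
move: (U) (wout) (pout); rewrite /= !inE !negb_or !andbT -!andbA.
case/and3P=> nab nac nbc /and3P [wna wnb wnc] /and3P [pna pnb pnc].
have bw : adj b w by rewrite adj_sym.
have [/existsP [q /and3P [qout qa qp]]|noq] :=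
  boolP [exists q : G, [&& q \notin [:: a; b; c], adj q a & q != p]].
  have qb : q != b by apply: contraNneq qout => ->; rewrite !inE eqxx orbT.
  have [G'conn lt_index pa1 pb1] := move_leg ab pa pnb p_leaf qa qb qp.
  apply: H3_below_lt lt_index _ => //; set G' := move_edge a b p in pa1 pb1 *.
  have far x y : x \notin [:: a; b; p] -> @adj G' x y = adj x y.
    exact: move_edge_far.
  have w_far : w \notin [:: a; b; p].
    by rewrite !inE !negb_or wna wnb eq_sym.
  apply: (@H3_below_embedding G' a p b w c).
  - by rewrite /= !inE !negb_or (eq_sym a p) pna nab (eq_sym a w) wna nac pnb pw pnc
      (eq_sym b w) wnb nbc wnc.
  - by rewrite (@adj_sym G').
  - by [].
  - by rewrite (@adj_sym G') far.
  - by rewrite far.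
  move=> x; rewrite !inE !negb_or => /and5P [xa xp xb xw xc].
  have x_far : x \notin [:: a; b; p] by rewrite !inE !negb_or xa xb.
  by rewrite !far //; apply: cover3_adj => //; rewrite !inE !negb_or xa xb.
apply: (@H3_below_embedding G p a b w c) => //.
  by rewrite /= !inE !negb_or pna pnb pw pnc nab (eq_sym a w) wna nac
    (eq_sym b w) wnb nbc wnc.
move=> x; rewrite !inE !negb_or => /and5P [xp xa xb xw xc].
have xout : x \notin [:: a; b; c] by rewrite !inE !negb_or xa xb.
have := cover3_adj cov xout; have -> : adj x a = false.
  by apply: contraNF noq => xa1; apply/existsP; exists x; rewrite xout xa1.
by move=> /= ->; rewrite orbT.
Qed.

(* Otherwise [a] and its pendant neighbours would form a component. *)
Lemma cover3_inner_edge (a b c : G) : cover3 a b c ->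
  (forall y, y \notin [:: a; b; c] -> adj y a -> ~~ adj y b /\ ~~ adj y c) ->
  adj a b || adj a c.
Proof.
move=> cov leaf; have [U _ _] := cov; apply: contraT; rewrite negb_or => /andP [ab ac].
pose P x := (x == a) || (x \notin [:: a; b; c]) && adj x a.
have : P b.
  apply: (connected_closed Gconn (x := a)); first by rewrite /P eqxx.
  move=> x y /orP [/eqP -> ay|/andP [xout xa] xy].
    rewrite /P; have [//|ya] := eqVneq y a.
    rewrite [adj y a]adj_sym ay andbT /= !inE !negb_or ya.
    by apply/and3P; split=> //; [apply: contraNneq ab => <- | apply: contraNneq ac => <-].
  have [xb xc] := leaf x xout xa.
  by rewrite /P (cover3_leaf cov xout xb xc xy) eqxx.
rewrite /P !inE eqxx orbT andFb orbF eq_sym.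
by move: U; rewrite /= !inE negb_or; case: (a == b).
Qed.

(** If [w] also meets [a], any fourth vertex outside the cover reduces to [H3_below_center].
    Otherwise [a] is attached either through an outside vertex, giving two links, or through an edge
    inside the cover, giving a leg. *)
Lemma H3_below_link (a b c w : G) : cover3 a b c ->
  w \notin [:: a; b; c] -> adj w b -> adj w c -> H3_below G.
Proof.
move=> cov wout wb wc; have [U ind out] := cov.
have cov' : cover3 a c b := cover3_rot (cover3_swap cov).
have E x : (x \notin [:: a; c; b]) = (x \notin [:: a; b; c]).
  by rewrite !inE [(x == c) || _]orbC.
have [wa|wa] := boolP (adj w a).
  have [r rout] : exists r, r \notin [:: a; b; c; w].
    apply/existsP; apply: contraLR G_card; rewrite negb_exists => /forallP all_in.
    rewrite -ltnNge; apply: (@leq_ltn_trans 4) => //.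
    apply: leq_trans (card_size [:: a; b; c; w]); apply: subset_leq_card.
    by apply/subsetP => x _; have := all_in x; rewrite negbK.
  have rabc : r \notin [:: a; b; c].
    by apply: contra rout; rewrite !inE; case/or3P => ->; rewrite ?orbT.
  have wr : w != r by apply: contraNneq rout => <-; rewrite !inE eqxx !orbT.
  have covb : cover3 b a c := cover3_swap cov.
  have Eb x : (x \notin [:: b; a; c]) = (x \notin [:: a; b; c]).
    by rewrite !inE orbCA.
  have /or3P [ra|rb|rc] := cover3_adj cov rabc.
  - by apply: (H3_below_center covb _ _ wr); rewrite ?Eb.
  - exact: (H3_below_center cov _ _ wr).
  - by apply: (H3_below_center cov' _ _ wr); rewrite ?E.
have [p pout ap] := out a (mem_head _ _).
have pa : adj p a by rewrite adj_sym.
have [/existsP [y /and3P [yout ya ybc]]|noy] :=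
  boolP [exists y : G, [&& y \notin [:: a; b; c], adj y a & adj y b || adj y c]].
  have yw : y != w by apply: contraNneq wa => <-.
  case/orP: ybc => [yb|yc]; first exact: (H3_below_two_links cov yout wout).
  by apply: (H3_below_two_links cov' _ _ yw); rewrite ?E.
have /orP [ab|ac] : adj a b || adj a c.
  apply: (cover3_inner_edge cov) => y yout ya; apply/andP; rewrite -negb_or.
  by apply: contra noy => ybc; apply/existsP; exists y; rewrite yout ya.
- exact: (H3_below_leg cov wout pout).
- by apply: (H3_below_leg cov' (w := w) (p := p)); rewrite ?E.
Qed.

End Cover.
End Structure.

Section Cover3.
Variables (R : realType) (alpha : R) (G : sgraph).
Hypotheses (alpha_ge0 : 0 <= alpha) (alpha_lt1 : alpha < 1).
Hypotheses (Gconn : connected G) (G_card : (9 <= #|G|)%N).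

(* If [p] is the only pendant vertex at [c], the cover {a, b, p} links [b] and
   [p] through [c]; otherwise an edge move creates the link. *)
Lemma H3_below_path (a b c : G) : cover3 a b c ->
  (forall w x y, w \notin [:: a; b; c] -> x \in [:: a; b; c] ->
     y \in [:: a; b; c] -> adj w x -> adj w y -> x = y) ->
  adj a b -> adj b c -> H3_below alpha G.
Proof.
move=> cov leaf ab bc; have [U ind out] := cov.
have [ain bin cin] : [/\ a \in [:: a; b; c], b \in [:: a; b; c] & c \in [:: a; b; c]].
  by rewrite !inE !eqxx !orbT.
have [p pout cp] := out c cin; have pc : adj p c by rewrite adj_sym.
have [y0 y0out ay0] := out a ain; have y0a : adj y0 a by rewrite adj_sym.
have cb : adj c b by rewrite adj_sym.
have p_leaf y : adj p y -> y = c.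
  move=> py; have /negPn yin : ~~ (y \notin [:: a; b; c]).
    by apply: contraL py => /(ind _ _ pout).
  exact: leaf pout yin cin py pc.
move: (U) (pout) (y0out); rewrite /= !inE !negb_or !andbT -!andbA.
case/and3P=> nab nac nbc /and3P [npa npb npc] /and3P [ny0a ny0b ny0c].
have y0p : y0 != p.
  by apply: contraTneq y0a => ->; apply/negP => /p_leaf ac; rewrite ac eqxx in nac.
have [/existsP [q /and3P [qout qc qp]]|noq] :=
  boolP [exists q : G, [&& q \notin [:: a; b; c], adj q c & q != p]].
  have qb : q != b by apply: contraNneq qout => ->.
  have [G'conn lt_index pc1 pb1] :=
    move_leg alpha_ge0 alpha_lt1 Gconn cb pc npb p_leaf qc qb qp.
  apply: H3_below_lt lt_index _ => //; set G' := move_edge c b p in G'conn pc1 pb1 *.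
  have far x y : x \notin [:: c; b; p] -> @adj G' x y = adj x y.
    exact: move_edge_far.
  have out_far x : x \notin [:: a; b; c] -> x != p -> x \notin [:: c; b; p].
    by rewrite !inE !negb_or => /and3P [_ -> ->] ->.
  apply: (@H3_below_link _ _ alpha_ge0 alpha_lt1 G' G'conn G_card a b c p) => //.
  split=> // [x y xout yout|x].
    have [->|xp] := eqVneq x p; last by rewrite far ?ind ?out_far.
    have [->|yp] := eqVneq y p; first by rewrite adj_irr.
    by rewrite (@adj_sym G') far ?ind ?out_far.
  rewrite !inE => /or3P [] /eqP ->.
  - exists y0 => //; rewrite far // !inE !negb_or nac nab eq_sym.
    exact: npa.
  - by exists p => //; rewrite (@adj_sym G').
  - by exists p => //; rewrite (@adj_sym G').
apply: (@H3_below_link _ _ alpha_ge0 alpha_lt1 G Gconn G_card a b p c) => //; last first.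
  by rewrite !inE !negb_or eq_sym nac (eq_sym c b) nbc eq_sym npc.
(* Exchanging [c] for [p] keeps the complement independent: only [p] among the outside vertices was
   adjacent to [c]. *)
have in_out x : x \notin [:: a; b; p] -> x = c \/ x \notin [:: a; b; c] /\ ~~ adj x c.
  rewrite !inE !negb_or => /and3P [xa xb xp].
  have [->|xc] := eqVneq x c; [by left | right].
  rewrite xa xb; split=> //; apply: contra noq => xc1.
  by apply/existsP; exists x; rewrite !inE !negb_or xa xb xc xc1.
split.
- by rewrite /= !inE !negb_or nab (eq_sym a p) npa (eq_sym b p) npb.
- move=> x y /in_out [->|[xout xc]] /in_out [->|[yout yc]] //.
  + by rewrite adj_irr.
  + by rewrite adj_sym.
  + exact: ind.
have c_out : c \notin [:: a; b; p].
  by rewrite !inE !negb_or eq_sym nac (eq_sym c b) nbc eq_sym npc.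
move=> x; rewrite !inE => /or3P [] /eqP ->.
- by exists y0 => //; rewrite !inE !negb_or ny0a ny0b y0p.
- by exists c.
- by exists c.
Qed.

(** Either an outside vertex links two cover vertices, or all outside vertices are pendant. In the
    latter case each cover vertex has a neighbour in the cover, so the cover contains a path on its
    three vertices. *)
Lemma H3_below_cover3 (a b c : G) : cover3 a b c -> H3_below alpha G.
Proof.
move=> cov.
have cov_bca : cover3 b c a := cover3_rot cov.
have cov_cab : cover3 c a b := cover3_rot cov_bca.
have cov_bac : cover3 b a c := cover3_swap cov.
have cov_acb : cover3 a c b := cover3_rot cov_bac.
have E_bca : [:: b; c; a] =i [:: a; b; c].
  by move=> x; rewrite !inE orbA orbC.
have E_cab : [:: c; a; b] =i [:: a; b; c].
  by move=> x; rewrite !inE orbC orbA.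
have E_bac : [:: b; a; c] =i [:: a; b; c] by move=> x; rewrite !inE orbCA.
have E_acb : [:: a; c; b] =i [:: a; b; c].
  by move=> x; rewrite !inE [(x == c) || _]orbC.
have [/existsP [w /andP [wout]]|nolink] := boolP [exists w : G,
    (w \notin [:: a; b; c]) &&
    [|| adj w b && adj w c, adj w c && adj w a | adj w a && adj w b]].
  case/or3P => /andP [w1 w2].
  - exact: (H3_below_link alpha_ge0 alpha_lt1 Gconn G_card cov wout).
  - by apply: (H3_below_link alpha_ge0 alpha_lt1 Gconn G_card cov_bca _ w1 w2);
      rewrite E_bca.
  - by apply: (H3_below_link alpha_ge0 alpha_lt1 Gconn G_card cov_cab _ w1 w2);
      rewrite E_cab.
have no2 w : w \notin [:: a; b; c] ->
    [/\ ~~ (adj w b && adj w c), ~~ (adj w c && adj w a) & ~~ (adj w a && adj w b)].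
  move=> wout; apply/and3P; rewrite -!negb_or; apply: contra nolink => w2.
  by apply/existsP; exists w; rewrite wout.
have leaf w x y : w \notin [:: a; b; c] -> x \in [:: a; b; c] ->
    y \in [:: a; b; c] -> adj w x -> adj w y -> x = y.
  move=> /no2 [n1 n2 n3]; rewrite !inE => /or3P [] /eqP -> /or3P [] /eqP -> // wx wy;
    by rewrite wx wy in n1 n2 n3.
have ia : adj a b || adj a c.
  apply: (cover3_inner_edge Gconn cov) => y /no2 [_ n2 n3] ya.
  by move: n2 n3; rewrite ya andbT /=.
have ib : adj b c || adj b a.
  apply: (cover3_inner_edge Gconn cov_bca) => y; rewrite E_bca => /no2 [n1 _ n3] yb.
  by move: n1 n3; rewrite yb andbT /=.
have ic : adj c a || adj c b.
  apply: (cover3_inner_edge Gconn cov_cab) => y; rewrite E_cab => /no2 [n1 n2 _] yc.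
  by move: n1 n2; rewrite yc andbT /=.
have leaf_bac w x y : w \notin [:: b; a; c] -> x \in [:: b; a; c] ->
    y \in [:: b; a; c] -> adj w x -> adj w y -> x = y.
  by rewrite !E_bac; apply: leaf.
have leaf_acb w x y : w \notin [:: a; c; b] -> x \in [:: a; c; b] ->
    y \in [:: a; c; b] -> adj w x -> adj w y -> x = y.
  by rewrite !E_acb; apply: leaf.
case/orP: ia => [ab|ac].
  have [bc|nbc] := boolP (adj b c); first exact: (H3_below_path cov leaf).
  have ca : adj c a by move: ic; rewrite [adj c b]adj_sym (negbTE nbc) orbF.
  by apply: (H3_below_path cov_bac leaf_bac); rewrite adj_sym.
have [bc|nbc] := boolP (adj b c).
  by apply: (H3_below_path cov_acb leaf_acb); rewrite // adj_sym.
have ba : adj b a by move: ib; rewrite (negbTE nbc).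
exact: (H3_below_path cov_bac leaf_bac).
Qed.

End Cover3.

(** The complement of a maximum independent set [I]: a vertex there with no neighbour in [I] could
    be added to [I]. *)
Lemma exists_cover3 (G : sgraph) : connected G -> (9 <= #|G|)%N ->
  independence_number G = (#|G| - 3)%N -> exists a b c : G, cover3 a b c.
Proof.
move=> Gconn G_card indG.
have ind0 : @independent G set0 by apply/forall_inP => x; rewrite inE.
have [I indI IE] := eq_bigmax_cond (A := fun S => @independent G S) (fun S => #|S|)
  (introT card_gt0P (ex_intro _ set0 ind0)).
have maxI (S : {set G}) : independent S -> (#|S| <= #|G| - 3)%N.
  by move=> indS; rewrite -indG; apply: (leq_bigmax_cond (P := fun S => independent S) (F := fun S => #|S|)).
have cardI : #|I| = (#|G| - 3)%N by rewrite -indG /independence_number IE.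
have cardC : size (enum (~: I)) = 3.
  by rewrite -cardE cardsCs setCK cardI subKn // (leq_trans _ G_card).
have memC x : (x \in enum (~: I)) = (x \notin I) by rewrite mem_enum inE.
have UC := enum_uniq (mem (~: I)).
case: (enum (~: I)) cardC memC UC => [|a [|b [|c [|d s]]]] // _ memC UC.
have indIP x y : x \in I -> y \in I -> ~~ adj x y.
  by move=> xI yI; have /forall_inP/(_ x xI)/forall_inP/(_ y yI) := indI.
exists a, b, c; split=> // [x y|x xC].
  by rewrite !memC !negbK; apply: indIP.
have [/existsP [y /andP [yI xy]]|noy] := boolP [exists y : G, (y \in I) && adj x y].
  by exists y => //; rewrite memC yI.
have noyP y : y \in I -> ~~ adj x y.
  by move=> yI; apply: contra noy => xy; apply/existsP; exists y; rewrite yI.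
have : (#|x |: I| <= #|G| - 3)%N.
  apply: maxI; apply/forall_inP => u; rewrite !inE => uI.
  apply/forall_inP => v; rewrite !inE => vI.
  case/orP: uI => [/eqP ->|uI]; case/orP: vI => [/eqP ->|vI].
  - by rewrite adj_irr.
  - exact: noyP.
  - by rewrite adj_sym noyP.
  - exact: indIP.
by rewrite cardsU1 -memC xC cardI ltnn.
Qed.

(** * Extremal graphs *)

Section Extremal.
Variables (R : realType) (alpha : R) (G : sgraph).
Hypotheses (alpha_ge0 : 0 <= alpha) (alpha_lt1 : alpha < 1).
Hypotheses (Gconn : connected G) (G_card : (9 <= #|G|)%N)
  (indG : independence_number G = (#|G| - 3)%N)
  (G_min : forall H : sgraph, #|H| = #|G| -> connected H ->
     independence_number H = (#|G| - 3)%N ->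
     A_index G alpha <= A_index H alpha).

Lemma extremal_le_H3 (s t k : nat) : (s + t + k = #|G| - 5)%N ->
  A_index G alpha <= A_index (H3 s t k) alpha.
Proof.
move=> stk; have cardH : #|H3 s t k| = #|G|.
  by rewrite card_H3 stk subnKC // (leq_trans _ G_card).
apply: G_min => //; first exact: H3_connected.
rewrite H3_independence ?cardH // stk subn_gt0.
exact: leq_trans G_card.
Qed.

Lemma extremal_H3 : exists s t k : nat,
  [/\ (s + t + k = #|G| - 5)%N, (s <= k + 1)%N, (k <= s + 1)%N,
      isomorphic G (H3 s t k) & A_index G alpha = A_index (H3 s t k) alpha].
Proof.
have [a [b [c cov]]] := exists_cover3 Gconn G_card indG.
have [s [t [k [stk [iso|lt_H3]]]]] :=
  H3_below_cover3 alpha_ge0 alpha_lt1 Gconn G_card cov; last first.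
  by have := lt_le_trans lt_H3 (extremal_le_H3 stk); rewrite ltxx.
have eqA : A_index G alpha = A_index (H3 s t k) alpha.
  by apply: (A_index_iso alpha_lt1) iso; [rewrite card_H3 | apply: H3_connected].
exists s, t, k; split=> //.
  rewrite leqNgt; apply/negP => s_gt; case: s s_gt stk iso eqA => // s s_gt stk iso eqA.
  have sum' : (s + t + k.+1 = #|G| - 5)%N by rewrite -stk addnS !addSn.
  have /(H3_balance alpha_ge0 alpha_lt1 t) : (k < s)%N by rewrite -ltnS -addn1.
  by rewrite -eqA ltNge extremal_le_H3.
rewrite leqNgt; apply/negP => k_gt; case: k k_gt stk iso eqA => // k k_gt stk iso eqA.
have sum' : (s.+1 + t + k = #|G| - 5)%N by rewrite -stk addnS !addSn.
have /(H3_balance_sym alpha_ge0 alpha_lt1 t) : (s < k)%N by rewrite -ltnS -addn1.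
by rewrite -eqA ltNge extremal_le_H3.
Qed.

Lemma extremal_target (s0 t0 : nat) : 2^-1 <= alpha -> (2 <= s0)%N ->
  (t0 < s0)%N -> (s0 <= t0 + 3)%N -> (s0 + t0 + s0 = #|G| - 5)%N ->
  isomorphic G (H3 s0 t0 s0).
Proof.
move=> half_le s0_ge2 t0_lt s0_le sum0.
have [s [t [k [stk sk ks iso eqA]]]] := extremal_H3.
have [/eqP E|neq] := boolP ((s, t, k) == (s0, t0, s0)).
  by case: E iso => -> -> ->.
have := H3_target_gt alpha_ge0 alpha_lt1 half_le s0_ge2 t0_lt s0_le
  (etrans stk (esym sum0)) sk ks neq.
by rewrite -eqA ltNge extremal_le_H3.
Qed.

End Extremal.

Theorem theorem1p3 (R : realType) (n : nat) (alpha : R) (G : sgraph)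
  (n_ge9 : (9 <= n)%N)
  (alpha_ge0 : 0 <= alpha) (alpha_lt1 : alpha < 1)
  (G_order : #|G| = n)
  (G_connected : connected G)
  (G_indep : independence_number G = (n - 3)%N)
  (G_min : forall H : sgraph,
     #|H| = n -> connected H -> independence_number H = (n - 3)%N ->
     A_index G alpha <= A_index H alpha) :
  [/\ exists s t k : nat,
        [/\ `|s%:Z - k%:Z| <= 1, (s + t + k)%N = (n - 5)%N
          & isomorphic G (H3 s t k)],
      forall m : nat, 2^-1 <= alpha -> n = (3 * m)%N ->
        isomorphic G (H3 (m - 1) (m - 3) (m - 1)),
      forall m : nat, 2^-1 <= alpha -> n = (3 * m + 1)%N ->
        isomorphic G (H3 (m - 1) (m - 2) (m - 1))
    & forall m : nat, 11%:R / 20%:R <= alpha -> n = (3 * m + 2)%N ->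
        isomorphic G (H3 m (m - 3) m)].
Proof.
subst n; have target := extremal_target alpha_ge0 alpha_lt1 G_connected n_ge9 G_indep G_min.
split.
- have [s [t [k [stk sk ks iso _]]]] :=
    extremal_H3 alpha_ge0 alpha_lt1 G_connected n_ge9 G_indep G_min.
  by exists s, t, k; split=> //; clear -sk ks; lia.
(* In all three cases [9 <= n] forces [3 <= m], so the truncated subtractions are exact; the
   differences [s0 - t0] are 2, 1 and 3 in turn. *)
- move=> m half_le nE; rewrite nE in n_ge9 target.
  by apply: target => //; clear -n_ge9; lia.
- move=> m half_le nE; rewrite nE in n_ge9 target.
  by apply: target => //; clear -n_ge9; lia.
- move=> m a_ge nE; rewrite nE in n_ge9 target.
  apply: target => //; [|clear -n_ge9; lia..].
  by apply: le_trans a_ge; lra.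
Qed.
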